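(* Let $B$ be a connected building set on $[n+1]$ such that the nestohedron $P_B$ is flag. Then: (1) $P_B$ can be obtained from the $n$-dimensional cube $I^n$ by successive shavings of faces of codimension 2; (2) the permutohedron $Pe^n$ can be obtained from $P_B$ by successive shavings of faces of codimension 2.
   Context: Write $[m]=\{1,\dots,m\}$. A building set on $[n+1]$ is a collection $B$ of nonempty subsets of $[n+1]$ such that (i) $\{i\}\in B$ for all $i\in[n+1]$; (ii) if $S_1,S_2\in B$ and $S_1\cap S_2\ne\emptyset$ then $S_1\cup S_2\in B$. It is connected if $[n+1]\in B$. The nestohedron is the Minkowski sum $P_B=\sum_{S\in B}\Delta^S\subset\mathbb{R}^{n+1}$, where $\Delta^S=\operatorname{conv}\{e_i: i\in S\}$ and $e_1,\dots,e_{n+1}$ is the standard basis; for $B$ connected it is a simple $n$-dimensional polytope. The permutohedron $Pe^n$ is the nestohedron of the building set of all nonempty subsets of $[n+1]$. A convex polytope is simple if each vertex lies in exactly $\dim P$ facets, and flag if any collection of pairwise intersecting facets has nonempty intersection. Face shaving: let $P\subset\mathbb{R}^n$ be a simple $n$-dimensional polytope with $0$ in its interior, $G$ a nonempty proper face, and $l_G$ a linear function with $l_G\le 1$ on $P$ and $\{x\in P: l_Gx=1\}=G$. The polytope $Q=\{x\in P: l_Gx\le 1-\varepsilon\}$, with $\varepsilon>0$ so small that every vertex of $P$ not in $G$ satisfies $l_Gx<1-\varepsilon$, is said to be obtained from $P$ by shaving the face $G$. $Q$ is simple and its combinatorial type depends only on the combinatorial type of $P$ and on $G$; hence shaving is considered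 for combinatorial polytopes (polytopes up to combinatorial equivalence). ''Obtained by successive shavings'' means via a finite (possibly empty) sequence of shavings, up to combinatorial equivalence; each shaved face has codimension 2 in the polytope from which it is shaved. *)

(* Defs.v *)
From HB Require Import structures.
From mathcomp Require Import all_boot all_order all_algebra.
From mathcomp Require Import all_classical all_reals all_analysis.
Set Implicit Arguments.
Unset Strict Implicit.
Unset Printing Implicit Defensive.
Import Order.TTheory GRing.Theory Num.Theory.
Import numFieldNormedType.Exports.
Local Open Scope classical_set_scope.
Local Open Scope ring_scope.

Definition convex_hull (R : realType) d (A : set 'rV[R]_d) : set 'rV[R]_d :=
  smallest (@convex_set R 'rV[R]_d) A.

Definition polytope (R : realType) d (P : set 'rV[R]_d) : Prop :=
  exists2 A : set 'rV[R]_d, finite_set A & P = convex_hull A.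

(* [U] is the direction of the affine hull of [P].  The relation holds for no
   [k] when [P] is empty. *)
Definition has_dim (R : realType) d (P : set 'rV[R]_d) (k : nat) : Prop :=
  exists (x0 : 'rV[R]_d) (U : {vspace 'rV[R]_d}),
    [/\ P x0,
        \dim U = k,
        forall x, P x -> x - x0 \in U
      & forall W : {vspace 'rV[R]_d},
          (forall x, P x -> x - x0 \in W) -> (U <= W)%VS].

(* The empty set (l = 0, c = 1) and P itself (l = 0, c = 0) are faces. *)
Definition face (R : realType) d (P F : set 'rV[R]_d) : Prop :=
  exists (l : {scalar 'rV[R]_d}) (c : R),
    (forall x, P x -> l x <= c) /\ F = [set x | P x /\ l x = c].

Definition face_codim (R : realType) d (P F : set 'rV[R]_d) (c : nat) : Prop :=
  face P F /\ exists k, has_dim F k /\ has_dim P (k + c).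

Definition facet (R : realType) d (P F : set 'rV[R]_d) : Prop :=
  face_codim P F 1.

Definition vertex (R : realType) d (P : set 'rV[R]_d) (v : 'rV[R]_d) : Prop :=
  face P [set v].

Definition is_simple (R : realType) d (P : set 'rV[R]_d) : Prop :=
  exists2 k, has_dim P k &
    forall v, vertex P v -> ([set F | facet P F /\ F v] #= `I_k)%card.

Definition is_flag (R : realType) d (P : set 'rV[R]_d) : Prop :=
  forall C : set (set 'rV[R]_d),
    C `<=` facet P ->
    (forall F G, C F -> C G -> F `&` G !=set0) ->
    \bigcap_(F in C) F !=set0.

(* Isomorphism of face lattices; the ambient dimensions may differ. *)
Definition comb_equiv (R : realType) d e
    (P : set 'rV[R]_d) (Q : set 'rV[R]_e) : Prop :=
  exists f : set 'rV[R]_d -> set 'rV[R]_e,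
    set_bij (face P) (face Q) f /\
    forall F G, face P F -> face P G -> (F `<=` G <-> f F `<=` f G).

(* [Q] is obtained from the full-dimensional polytope [P] by shaving [G]. *)
Definition shaving (R : realType) n (P G Q : set 'rV[R]_n) : Prop :=
  [/\ polytope P, is_simple P, has_dim P n & P° 0] /\
  [/\ face P G, G !=set0 & G <> P] /\
  exists (l : {scalar 'rV[R]_n}) (eps : R),
    [/\ forall x, P x -> l x <= 1,
        G = [set x | P x /\ l x = 1],
        0 < eps,
        forall v, vertex P v -> ~ G v -> l v < 1 - eps
      & Q = [set x | P x /\ l x <= 1 - eps]].

(* [obtained_by_codim2_shavings Q P]: [Q] is obtained from [P].
   Shaving needs a full-dimensional realization with 0 in its interior, so
   every step may first replace the current polytope by an equivalent one,
   possibly in another ambient space. *)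
Inductive obtained_by_codim2_shavings (R : realType) e (Q : set 'rV[R]_e) :
    forall d, set 'rV[R]_d -> Prop :=
  | codim2_shavings_none d (P : set 'rV[R]_d) :
      comb_equiv P Q -> obtained_by_codim2_shavings Q P
  | codim2_shavings_step d n (P : set 'rV[R]_d) (P' G Q' : set 'rV[R]_n) :
      comb_equiv P P' ->
      face_codim P' G 2 ->
      shaving P' G Q' ->
      obtained_by_codim2_shavings Q Q' ->
      obtained_by_codim2_shavings Q P.

Definition building_set n (B : {set {set 'I_n.+1}}) : Prop :=
  [/\ finset.set0 \notin B,
      forall i : 'I_n.+1, [set i]%SET \in B
    & forall S1 S2, S1 \in B -> S2 \in B ->
        S1 :&: S2 != finset.set0 -> S1 :|: S2 \in B].

Definition connected_building_set n (B : {set {set 'I_n.+1}}) : Prop :=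
  building_set B /\ [set: 'I_n.+1]%SET \in B.

Definition simplex (R : realType) d (S : {set 'I_d}) : set 'rV[R]_d :=
  convex_hull [set delta_mx 0 i | i in [set i | i \in S]].

Definition minkowski_sum (R : realType) d (I : finType) (B : {set I})
    (A : I -> set 'rV[R]_d) : set 'rV[R]_d :=
  [set \sum_(i in B) y i | y in [set y : I -> 'rV[R]_d |
                                  forall i, i \in B -> A i (y i)]].

Definition nestohedron (R : realType) n (B : {set {set 'I_n.+1}}) :
    set 'rV[R]_n.+1 :=
  minkowski_sum B (@simplex R n.+1).

Arguments nestohedron R {n} B.

Definition permutohedron (R : realType) n : set 'rV[R]_n.+1 :=
  nestohedron R [set S : {set 'I_n.+1} | S != finset.set0]%SET.

Definition cube (R : realType) n : set 'rV[R]_n :=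
  [set x | forall i, 0 <= x 0 i <= 1].

Arguments permutohedron R n : clear implicits.
Arguments cube R n : clear implicits.

(* Main.v *)
Require Import Defs.
From HB Require Import structures.
From mathcomp Require Import all_boot all_order all_algebra.
From mathcomp Require Import all_classical all_reals all_analysis.
From mathcomp Require Import ring lra zify.
Set Implicit Arguments.
Unset Strict Implicit.
Unset Printing Implicit Defensive.
Import Order.TTheory GRing.Theory Num.Theory.
Import numFieldNormedType.Exports.
Local Open Scope classical_set_scope.
Local Open Scope ring_scope.

(** Volodin's argument, in terms of realizations by inequalities.

    A family [N] of members of the building set [B], containing the ground
    set, is nested when the union of a nonempty subfamily of [N] lies in [B]
    only if it is itself a member of that subfamily. Give each member of [B]
    a positive weight, and let the bound of a set [U] be the total weight of
    the members of [B] inside [U]. The polytope [weighted B] asks that the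
    coordinates over each [S] in [B] sum to at least the bound of [S], with
    equality for the ground set. An uncrossing argument shows that the sets
    tight at a point form a nested family ([weighted_nested]); conversely
    [spread_sum N], a weighted sum of points of simplices, has exactly [N]
    as its tight sets ([tight_spread_sum]). The faces of a polytope given by
    inequalities are the faces cut out by the tight sets of its points
    ([face_tight_face]), so the nonempty faces of [weighted B] are the
    nested families with reversed inclusion, whatever the weights, and
    independence of the nested families ([charv_free]) makes the polytope
    simple. With all weights 1 this polytope is the nestohedron
    ([nestohedronE]): a vertex of the former is determined by its tight
    sets, so it coincides with some [spread_sum N] and lies in the Minkowski
    sum.

    Suppose [S] and [T] are disjoint members of [B], their union is not in [B],
    and adjoining it yields a building set.  Weights can be found, for both
    building sets, that make the bound a fixed function growing fast with the
    size of the set ([growth_weights]).  Then the polytope of the larger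
    building set is that of the smaller one cut by the single inequality of
    [S :|: T].  On the polytope of [B] the coordinates over [S :|: T] sum to at
    least the bounds of [S] and [T] together, with equality exactly on the
    codimension 2 face where [S] and [T] are tight.  A vertex outside this face
    has a family of tight sets that is still nested for the larger building
    set, so it satisfies the new inequality strictly.  Hence the cut is a
    shaving ([shaving_step]).

    If [B] is contained in a building set [C] each of whose members with at
    least two elements splits into two disjoint members, such adjunctions lead
    from [B] to [C] ([exists_adjunction], [shavings_between]).  When the
    nestohedron is flag its building set has this splitting property
    ([flag_splits]), and so has the set of all nonempty subsets; this gives the
    permutohedron.  Splitting the ground set recursively inside [B] gives a
    binary tree whose nodes form a connected building set; a nested family of
    nodes chooses at most one child of each inner node, so its polytope has the
    face poset of the cube ([cube_complex]). *)

(** * Convex hulls *)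

Section Convexity.
Variables (R : realType) (d : nat).
Implicit Types (A : set 'rV[R]_d) (x y : 'rV[R]_d).

Lemma convex_setP A :
  convex_set A <->
  forall x y (t : R), A x -> A y -> 0 <= t <= 1 -> A (t *: x + (1 - t) *: y).
Proof.
split=> [cA x y t Ax Ay /andP[t0 t1]|cA x y t].
  by have := cA x y (Itv01 t0 t1); rewrite !inE; apply.
by rewrite !inE => Ax Ay; apply: cA => //; rewrite ge0 le1.
Qed.

Lemma convex_hull_convex A : convex_set (convex_hull A).
Proof.
apply/convex_setP => x y t hx hy ht C [cC AC].
by move/convex_setP: (cC); apply=> //; [apply: hx|apply: hy].
Qed.

Lemma sub_convex_hull A : A `<=` convex_hull A.
Proof. by move=> x Ax C [_]; apply. Qed.

Lemma convex_hull_sub A C : convex_set C -> A `<=` C -> convex_hull A `<=` C.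
Proof. by move=> cC AC x; apply; split. Qed.

Lemma convex_mean A (I : finType) (J : {set I}) (y : I -> 'rV[R]_d) :
    convex_set A -> J != finset.set0 -> (forall j, j \in J -> A (y j)) ->
  A (#|J|%:R^-1 *: \sum_(j in J) y j).
Proof.
move=> /convex_setP cA; move Ek : #|J| => k.
elim: k J Ek => [|k IH] J Jk /set0Pn[j jJ] AJ.
  by rewrite (cards0_eq Jk) inE in jJ.
have Jk' : #|J :\ j| = k by move: Jk; rewrite (cardsD1 j) jJ add1n => -[].
rewrite (big_setD1 j) //=.
have [J0|J0] := eqVneq (J :\ j) finset.set0.
  rewrite J0 big_set0 addr0; move: Jk'; rewrite J0 cards0 => <-.
  by rewrite invr1 scale1r; exact: AJ.
have k0 : k%:R != 0 :> R by rewrite pnatr_eq0 -Jk' cards_eq0.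
have k1 : k.+1%:R != 0 :> R by rewrite pnatr_eq0.
have := IH _ Jk' J0 (fun i iJ => AJ i (fintype.subsetP (subD1set _ _) i iJ)).
move=> /(cA _ _ k.+1%:R^-1 (AJ j jJ)) H.
rewrite scalerDr (_ : k.+1%:R^-1 *: \sum_(_ in _) _ =
  (1 - k.+1%:R^-1) *: (k%:R^-1 *: \sum_(i in J :\ j) y i)).
  by apply: H; rewrite invr_ge0 ler0n invf_le1 ?ler1n ?ltr0n.
rewrite scalerA; congr (_ *: _); rewrite -addn1 natrD in k1 *; field.
by apply/andP.
Qed.

End Convexity.

(** * Face posets and dimension *)

Section Dot.
Variables (R : realType) (d : nat).
Implicit Types a x y : 'rV[R]_d.

Definition dot a x : R := \sum_j a 0 j * x 0 j.

Fact dot_is_linear a : linear_for *%R (dot a).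
Proof.
move=> k x y; rewrite /dot mulr_sumr -big_split; apply: eq_bigr => j _.
by rewrite !mxE mulrDr mulrCA.
Qed.
HB.instance Definition _ a :=
  GRing.isLinear.Build R 'rV[R]_d R *%R (dot a) (dot_is_linear a).

Lemma dotC a x : dot a x = dot x a.
Proof. by apply: eq_bigr => j _; rewrite mulrC. Qed.

Lemma dot_suml (I : Type) (r : seq I) (P : pred I) (a : I -> 'rV[R]_d) x :
  dot (\sum_(i <- r | P i) a i) x = \sum_(i <- r | P i) dot (a i) x.
Proof. by rewrite dotC linear_sum; apply: eq_bigr => i _; rewrite dotC. Qed.

Lemma dot_mulmx e (M : 'M[R]_(d, e)) (a : 'rV[R]_e) x :
  \sum_j a 0 j * (x *m M) 0 j = dot (a *m M^T) x.
Proof.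
rewrite /dot; under eq_bigr do rewrite mxE mulr_sumr.
rewrite exchange_big; apply: eq_bigr => j _.
by rewrite mxE mulr_suml; apply: eq_bigr => i _; rewrite mxE; ring.
Qed.

End Dot.

Section HasDim.
Variables (R : realType) (d : nat).
Implicit Types P F : set 'rV[R]_d.

Lemma has_dim_unique P k k' : has_dim P k -> has_dim P k' -> k = k'.
Proof.
have le x (U : {vspace 'rV[R]_d}) y (V : {vspace 'rV[R]_d}) : P x ->
      (forall z, P z -> z - y \in V) ->
    (forall W : {vspace 'rV[R]_d},
       (forall z, P z -> z - x \in W) -> (U <= W)%VS) -> (U <= V)%VS.
  move=> Px PV; apply=> z Pz.
  have -> : z - x = (z - y) - (x - y) by rewrite opprB addrA subrK.
  by rewrite rpredB ?PV.
move=> [x [U [Px <- xU Umin]]] [y [V [Py <- yV Vmin]]].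
by apply/eqP; rewrite eqn_leq !dimvS //; [apply: (le y _ x)|apply: (le x _ y)].
Qed.

Lemma face0 P : face P set0.
Proof.
exists (dot 0), 1; split=> [x _|]; first by rewrite /= dotC linear0.
apply/seteqP; split=> x //= [_]; rewrite /= dotC linear0 => /esym/eqP.
by rewrite oner_eq0.
Qed.

(** The nonempty faces of [P] are indexed, with reversed inclusion, by the
    members of the family [K].  Polytopes sharing [K] are then combinatorially
    equivalent whatever their ambient spaces, so that no map between the
    polytopes themselves is ever needed. *)
Definition has_face_complex (T : finType) P (K : {set T} -> Prop) : Prop :=
  exists F : {set T} -> set 'rV[R]_d,
  [/\ forall N, K N -> face P (F N) /\ F N !=set0,
      forall G, face P G -> G !=set0 -> exists2 N, K N & G = F N
    & forall N M, K N -> K M -> (F N `<=` F M <-> M \subset N)].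

End HasDim.

Lemma comb_equiv_face_complex (R : realType) d e (T : finType)
    (K : {set T} -> Prop) (P : set 'rV[R]_d) (Q : set 'rV[R]_e) :
  has_face_complex P K -> has_face_complex Q K -> comb_equiv P Q.
Proof.
move=> [F [Fface Fsurj Fsub]] [F' [Fface' Fsurj' Fsub']].
pose f G := [set x | exists N, [/\ K N, G = F N & F' N x]].
have fF N : K N -> f (F N) = F' N.
  move=> KN; apply/seteqP; split=> [x [M [KM FE]]|x F'x]; last by exists N.
  suff -> : N = M by [].
  apply/eqP; rewrite finset.eqEsubset; apply/andP; split; last first.
    by apply/(Fsub _ _ KN KM); rewrite FE.
  by apply/(Fsub _ _ KM KN); rewrite FE.
have f0 : f set0 = set0.
  apply/seteqP; split=> // x [N [KN FE _]].
  by have [_] := Fface _ KN; rewrite -FE => -[].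
have Fne N : K N -> F N !=set0 by move=> /Fface[].
have Fne' N : K N -> F' N !=set0 by move=> /Fface'[].
have cases G : face P G -> G = set0 \/ exists2 N, K N & G = F N.
  move=> fG; have [->|G0] := pselect (G = set0); [by left|right].
  by apply: Fsurj => //; apply/set0P/eqP.
have mono G H : face P G -> face P H -> (G `<=` H <-> f G `<=` f H).
  move=> /cases[->|[N KN ->]] /cases[->|[M KM ->]]; rewrite ?f0 ?fF //.
  - by split=> _ x [].
  - by split=> _ x [].
  - by split=> NM; [have [x /NM] := Fne _ KN|have [x /NM] := Fne' _ KN].
  - by rewrite Fsub // Fsub'.
exists f; split=> //; split=> [G /cases[->|[N KN ->]]|G H|G /= fG].
- by rewrite /= f0; apply: face0.
- by rewrite /= fF //; have [] := Fface' _ KN.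
- rewrite !inE => fG fH E; apply/seteqP.
  by split; apply/mono => //; rewrite E.
have [->|G0] := pselect (G = set0); first by exists set0 => //; apply: face0.
have [|N KN ->] := Fsurj' G fG; first exact/set0P/eqP.
by exists (F N); [have [] := Fface _ KN|rewrite fF].
Qed.

(** * Systems of linear inequalities *)

Section LinearSystem.
Variables (R : realType) (d : nat) (T : finType).
Variables (a : T -> 'rV[R]_d) (c : T -> R) (D E : {set T}).

Definition solutions : set 'rV[R]_d :=
  [set x | forall i, i \in D ->
     c i <= dot (a i) x /\ (i \in E -> dot (a i) x = c i)].

Definition tight (x : 'rV[R]_d) : {set T} :=
  [set i in D | dot (a i) x == c i]%SET.

Definition tight_face (N : {set T}) : set 'rV[R]_d :=
  [set x | solutions x /\ N \subset tight x].

Lemma tightP x i : reflect (i \in D /\ dot (a i) x = c i) (i \in tight x).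
Proof. by rewrite inE; apply: (iffP andP) => -[? /eqP]. Qed.

Lemma solutions_convex : convex_set solutions.
Proof.
apply/convex_setP => x y t Px Py /andP[t0 t1] i iD.
have [cx ex] := Px i iD; have [cy ey] := Py i iD.
rewrite linearD !linearZ /=; split=> [|iE].
  have := ler_wpM2l t0 cx; have t1' : 0 <= 1 - t by rewrite subr_ge0.
  have := ler_wpM2l t1' cy; lra.
by rewrite ex // ey //; ring.
Qed.

Lemma sub_tight_eq (N : {set T}) x y : solutions x -> tight x = N -> solutions y ->
  N \subset tight y -> forall i, i \in N -> dot (a i) (y - x) = 0.
Proof.
move=> Px <- Py /fintype.subsetP Ny i ix.
have /tightP[_ ey] := Ny _ ix; have /tightP[_ ex] := ix.
by rewrite linearB /= ex ey subrr.
Qed.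

(** A direction that no tight inequality forbids can be followed for a while:
    the explicit step is harmless for each of the finitely many slacks. *)
Lemma small_step x u : solutions x ->
    (forall i, i \in tight x -> 0 <= dot (a i) u) ->
    (forall i, i \in D -> i \in E -> dot (a i) u = 0) ->
  exists2 eps : R, 0 < eps & solutions (x + eps *: u).
Proof.
move=> Px tu Eu.
(* [s i] is the inverse of the longest step allowed by inequality [i]. *)
pose s i := `|dot (a i) u| / (dot (a i) x - c i).
have s0 i : i \in D -> 0 <= s i.
  by move=> iD; rewrite mulr_ge0 // invr_ge0 subr_ge0; have [] := Px i iD.
have S0 : 0 < 1 + \sum_(i in D) s i by rewrite ltr_pwDl // sumr_ge0.
exists (1 + \sum_(i in D) s i)^-1; first by rewrite invr_gt0.
move=> i iD; have [cx ex] := Px i iD; rewrite linearD linearZ /=.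
split=> [|iE]; last by rewrite ex // Eu // mulr0 addr0.
have [it|it] := boolP (i \in tight x).
  by rewrite ler_wpDr // mulr_ge0 ?tu // invr_ge0 ltW.
have sl : 0 < dot (a i) x - c i.
  by rewrite subr_gt0 lt_neqAle cx andbT; move: it; rewrite inE iD eq_sym.
have si : s i <= 1 + \sum_(i in D) s i.
  rewrite (bigD1 i) //= addrA [1 + _]addrC -addrA lerDl addr_ge0 //.
  by apply: sumr_ge0 => j /andP[/s0].
rewrite -lerBlDl -opprB lerNl -mulrN.
rewrite (le_trans (ler_wpM2l _ (ler_norm _))) ?invr_ge0 ?(ltW S0) // normrN.
by rewrite mulrC ler_pdivrMr // mulrC -ler_pdivrMr.
Qed.

(** Following a direction that keeps the tight inequalities tight until the
    first other inequality becomes tight. *)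
Lemma long_step x u : solutions x ->
    (forall i, i \in tight x -> dot (a i) u = 0) ->
    (exists2 i, i \in D & dot (a i) u < 0) ->
  exists2 t : R, 0 < t &
    solutions (x + t *: u) /\ tight x \proper tight (x + t *: u).
Proof.
move=> Px tu [i0 i0D i0u].
pose f i := (dot (a i) x - c i) / - dot (a i) u.
pose Q := fun i => (i \in D) && (dot (a i) u < 0).
have Qi0 : Q i0 by rewrite /Q i0D.
have [i /andP[iD iu] imin] := @Order.TotalTheory.arg_minP _ _ _ i0 Q f Qi0.
have it : i \notin tight x by apply/negP => /tu iu0; rewrite iu0 ltxx in iu.
have slack j : j \in D -> j \notin tight x -> 0 < dot (a j) x - c j.
  move=> jD jt; have [cx _] := Px j jD.
  by rewrite subr_gt0 lt_neqAle cx andbT; move: jt; rewrite inE jD eq_sym.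
have f0 : 0 < f i by rewrite divr_gt0 ?slack // oppr_gt0.
have iE : dot (a i) (x + f i *: u) = c i.
  by rewrite linearD linearZ /= /f; field; rewrite lt_eqF.
exists (f i) => //; split.
  move=> j jD; have [cx ex] := Px j jD; rewrite linearD linearZ /=.
  split=> [|jE]; last first.
    by rewrite ex // tu ?mulr0 ?addr0 //; apply/tightP; rewrite ex.
  have [ju|ju] := leP 0 (dot (a j) u).
    by rewrite ler_wpDr // mulr_ge0 // ltW.
  have := imin j; rewrite /Q jD ju => /(_ isT).
  by rewrite [X in _ <= X]/f ler_pdivlMr ?oppr_gt0 //; lra.
apply/properP; split.
  apply/fintype.subsetP => j jt; have /tightP[jD ej] := jt; apply/tightP.
  by rewrite linearD linearZ /= tu // mulr0 addr0.
by exists i => //; apply/tightP.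
Qed.

(** These points are the vertices, described by linear algebra only. *)
Definition rigid : set 'rV[R]_d :=
  [set v | solutions v /\
     forall u, (forall i, i \in tight v -> dot (a i) u = 0) -> u = 0].

Lemma rigid_eq v x : rigid v -> solutions x -> tight v \subset tight x -> x = v.
Proof.
move=> [Pv rv] Px vx; apply/eqP; rewrite -subr_eq0; apply/eqP/rv => i.
exact: sub_tight_eq.
Qed.

Lemma finite_rigid : finite_set rigid.
Proof.
pose g (N : {set T}) := get [set v | rigid v /\ tight v = N].
apply: (@sub_finite_set _ _ (g @` setT)); last first.
  by apply: finite_image; apply: finite_finset.
move=> v rv; exists (tight v) => //.
have [] : [set w | rigid w /\ tight w = tight v] (g (tight v)).
  by apply: getPex; exists v.
by move=> [Pg rg] gv; apply/esym/rigid_eq => //; [exact: rv.1|rewrite gv].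
Qed.

(** Through a solution that is not rigid passes a line along which all tight
    inequalities stay tight.  Boundedness stops it on both sides at solutions
    with more tight inequalities. *)
Lemma solutions_hull :
    (forall u, (forall i, i \in D -> 0 <= dot (a i) u) ->
       (forall i, i \in D -> i \in E -> dot (a i) u = 0) -> u = 0) ->
  solutions = convex_hull rigid.
Proof.
move=> bounded; apply/seteqP; split; last first.
  by apply: convex_hull_sub => [|v []//]; exact: solutions_convex.
move=> x; have [k] := ubnP (#|D| - #|tight x|)%N.
elim: k x => // k IH x; rewrite ltnS => leDk Px.
have [rx|/existsNP[u /not_implyP[tu /eqP u0]]] :=
    pselect (forall u, (forall i, i \in tight x -> dot (a i) u = 0) -> u = 0).
  exact: sub_convex_hull.
have neg w : w != 0 -> (forall i, i \in tight x -> dot (a i) w = 0) ->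
    exists2 i, i \in D & dot (a i) w < 0.
  move=> w0 tw; apply: contrapT => nw; case/eqP: w0; apply: bounded.
    by move=> i iD; rewrite leNgt; apply/negP => iw; apply: nw; exists i.
  move=> i iD iE; apply: tw; apply/tightP; split=> //.
  by have [_ ->] := Px i iD.
have reach w : w != 0 -> (forall i, i \in tight x -> dot (a i) w = 0) ->
    exists2 t : R, 0 < t & convex_hull rigid (x + t *: w).
  move=> w0 tw; have [t t0 [Py ty]] := long_step Px tw (neg w w0 tw).
  exists t => //; apply: IH => //; apply: leq_trans leDk.
  rewrite ltn_sub2l // ?(proper_card ty) //.
  apply: leq_trans (proper_card ty) _; apply: subset_leq_card.
  by apply/fintype.subsetP => i /tightP[].
have [t t0 hx] := reach u u0 tu.
have [|i it|s s0 hy] := reach (- u); first by rewrite oppr_eq0.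
  by rewrite linearN /= tu // oppr0.
have ts : 0 < t + s by rewrite addr_gt0.
have := (convex_setP _).1 (@convex_hull_convex _ _ rigid) _ _ (s / (t + s)) hx hy.
have -> : 0 <= s / (t + s) <= 1.
  by rewrite divr_ge0 ?(ltW s0) ?(ltW ts) //= ler_pdivrMr // mul1r lerDr ltW.
move=> /(_ isT); congr (convex_hull rigid _).
apply/rowP => j; rewrite !mxE; field.
by rewrite gt_eqF.
Qed.

Lemma tight_face_face (N : {set T}) : N \subset D -> face solutions (tight_face N).
Proof.
move=> /fintype.subsetP ND.
exists (dot (- \sum_(i in N) a i)), (- \sum_(i in N) c i).
have sumE x : dot (- \sum_(i in N) a i) x = - \sum_(i in N) dot (a i) x.
  by rewrite dotC linearN /= dotC dot_suml.
split=> [x Px|].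
  rewrite /= sumE lerN2; apply: ler_sum => i iN.
  by have [] := Px i (ND i iN).
apply/seteqP; split=> x [Px] /=; rewrite /= sumE.
  move=> /fintype.subsetP Nx; split=> //; congr (- _).
  by apply: eq_bigr => i /Nx/tightP[].
move=> /oppr_inj ex; split=> //; apply/fintype.subsetP => i iN.
apply/tightP; split; first exact: ND.
have : \sum_(j in N) (dot (a j) x - c j) = 0 by rewrite sumrB ex subrr.
move/eqP; rewrite psumr_eq0 => [/allP/(_ i)|j /ND jD].
  by rewrite mem_index_enum iN subr_eq0 => /(_ isT)/eqP.
by rewrite subr_ge0; have [] := Px j jD.
Qed.

Lemma tight_midpoint x y : solutions x -> solutions y ->
  tight (2^-1 *: x + (1 - 2^-1) *: y) \subset tight x.
Proof.
move=> Px Py; apply/fintype.subsetP => i /tightP[iD].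
rewrite linearD !linearZ /= => e; apply/tightP; split=> //.
have [cx _] := Px i iD; have [cy _] := Py i iD; lra.
Qed.

Lemma tight_line x y : solutions x -> solutions y -> tight x \subset tight y ->
  exists2 eps : R, 0 < eps & solutions (x + eps *: (x - y)).
Proof.
move=> Px Py txy.
have txy0 i : i \in tight x -> dot (a i) (x - y) = 0.
  by move=> ix; rewrite -opprB linearN /= (sub_tight_eq Px erefl Py) ?oppr0.
apply: small_step => // [i /txy0 -> //|i iD iE]; apply: txy0.
by apply/tightP; split=> //; have [_ ->] := Px i iD.
Qed.

(** A nonempty face consists of the solutions at which everything is tight
    that is tight at a chosen point [x] of the face.  Minimality of the tight
    set of [x] gives one inclusion; for the other, the segment from a solution
    [y] to [x] can be prolonged beyond [x], so that the linear function
    cutting out the face cannot be smaller at [y] than at [x]. *)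
Lemma face_tight_face G : face solutions G -> G !=set0 ->
  exists2 x, G x & G = tight_face (tight x).
Proof.
move=> [l [b [lb ->]]] [z [Pz lz]].
pose p k := `[< exists2 x, solutions x /\ l x = b & #|tight x| = k >].
have exp : exists k, p k by exists #|tight z|; apply/asboolP; exists z.
have [m /asboolP[x [Px lx] tx] mmin] := ex_minnP exp.
exists x; first by [].
apply/seteqP; split=> y [Py].
  move=> ly; split=> //.
  set w := 2^-1 *: x + (1 - 2^-1) *: y.
  have Pw : solutions w.
    apply: (convex_setP _).1 => //; first exact: solutions_convex.
    by rewrite invr_ge0 ler0n invf_le1 ?ler1n.
  have lw : l w = b by rewrite linearD !linearZ /= lx ly; lra.
  have wx := tight_midpoint Px Py; rewrite -/w in wx.
  have wy := tight_midpoint Py Px.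
  rewrite addrC (_ : 1 - 2^-1 = 2^-1) in wy; last by lra.
  rewrite -[X in X *: y](_ : 1 - 2^-1 = 2^-1) -/w in wy; last by lra.
  have := mmin #|tight w|; have -> : p #|tight w| by apply/asboolP; exists w.
  move=> /(_ isT); rewrite -tx => le.
  by have /eqP <- : tight w == tight x by rewrite eqEcard wx.
move=> xy; split=> //; apply/eqP; rewrite eq_le lb //=.
have [e e0 Pe] := tight_line Px Py xy.
have := lb _ Pe; rewrite linearD linearZ linearB /= lx gerDl.
by rewrite pmulr_rle0 // subr_le0.
Qed.

Lemma tight_face_sub (N M : {set T}) x : solutions x -> tight x = N ->
  tight_face N `<=` tight_face M <-> M \subset N.
Proof.
move=> Px tx; split=> [/(_ x)|MN y [Py Ny]]; first by rewrite -tx => -[].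
by split=> //; apply: fintype.subset_trans MN Ny.
Qed.

(** Near a point with no tight inequalities other than those defining the face,
    every direction in [U] stays in the face. *)
Lemma has_dim_tight_face (U : {vspace 'rV[R]_d}) x : solutions x ->
    (forall u, u \in U <-> forall i, i \in tight x -> dot (a i) u = 0) ->
  has_dim (tight_face (tight x)) (\dim U).
Proof.
move=> Px UE; exists x, U; split=> //.
  by move=> y [Py xy]; apply/UE; apply: sub_tight_eq.
move=> W xW; apply/subvP => u /UE tu.
have [e e0 Pe] : exists2 e : R, 0 < e & solutions (x + e *: u).
  apply: small_step => // [i /tu -> //|i iD iE]; apply: tu; apply/tightP.
  by split=> //; have [_ ->] := Px i iD.
have : x + e *: u - x \in W.
  apply: xW; split=> //; apply/fintype.subsetP => i ix.
  have /tightP[iD ex] := ix; apply/tightP; split=> //.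
  by rewrite linearD linearZ /= tu // mulr0 addr0.
rewrite addrC addKr => /(rpredZ e^-1).
by rewrite scalerA mulVf ?gt_eqF // scale1r.
Qed.

Lemma vertex_rigid v : vertex solutions v -> rigid v.
Proof.
move=> fv; have [|x /= -> vE] := face_tight_face fv; first by exists v.
have Pv : solutions v by have : [set v] v by []; rewrite {1}vE => -[].
split=> // u tu.
have [e e0 Pe] : exists2 e : R, 0 < e & solutions (v + e *: u).
  apply: small_step => // [i /tu -> //|i iD iE]; apply: tu; apply/tightP.
  by split=> //; have [_ ->] := Pv i iD.
have : [set v] (v + e *: u).
  rewrite vE; split=> //; apply/fintype.subsetP => i iv.
  have /tightP[iD ev] := iv; apply/tightP; split=> //.
  by rewrite linearD linearZ /= tu // mulr0 addr0.
move=> /= /eqP; rewrite -subr_eq0 addrAC subrr add0r scaler_eq0.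
by rewrite gt_eqF //= => /eqP.
Qed.

End LinearSystem.

(** * Simple polytopes given by inequalities *)

Lemma card_set_finset (T : finType) (A : {set T}) :
  ([set i | i \in A] #= `I_#|A|)%card.
Proof.
have -> : [set i | i \in A] = @enum_val T (mem A) @` [set: 'I_#|A|].
  apply/seteqP; split=> [i iA|_ [k _ <-]]; last exact: enum_valP.
  by exists (enum_rank_in iA i) => //; rewrite enum_rankK_in.
apply: card_eq_trans (card_esym card_II).
by apply: inj_card_eq => x y _ _; apply: enum_val_inj.
Qed.

Section ComplexOfSystem.
Variables (R : realType) (d : nat) (T : finType).
Variables (a : T -> 'rV[R]_d) (c : T -> R) (D E : {set T}).
Variable K : {set T} -> Prop.
Hypothesis K_tight : forall x, solutions a c D E x -> K (tight a c D x).
Hypothesis K_attained : forall N, K N ->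
  exists2 x, solutions a c D E x & tight a c D x = N.

Local Notation P := (solutions a c D E).
Local Notation tight := (tight a c D).
Local Notation tight_face := (tight_face a c D E).
Local Notation rigid := (rigid a c D E).

Lemma system_face_complex : has_face_complex P K.
Proof.
exists tight_face; split=> [N KN|G fG G0|N M KN KM].
- have [x Px xN] := K_attained KN; split; last by exists x; split; rewrite ?xN.
  by apply: tight_face_face; rewrite -xN; apply/fintype.subsetP => i /tightP[].
- have [x Gx ->] := face_tight_face fG G0; exists (tight x) => //.
  by apply: K_tight; move: fG Gx => [l [b [_ ->]]] [].
- by have [x Px xN] := K_attained KN; apply: tight_face_sub Px xN.
Qed.

(** The combinatorial data of a simple polytope of dimension [m]: the base
    index [t] is tight everywhere (it accounts for an equation satisfied by the
    whole polytope) and each further tight inequality lowers the dimension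
    by one. *)
Variables (t : T) (m : nat).
Hypothesis K_base : K [set t]%SET.
Hypothesis K_mem : forall N, K N -> t \in N.
Hypothesis K_down : forall N M : {set T}, K N -> t \in M -> M \subset N -> K M.
Hypothesis K_dim : forall N, K N ->
  exists2 k, has_dim (tight_face N) k & (k + #|N| = m.+1)%N.

Lemma tight_face_dim (N : {set T}) k :
  K N -> (k + #|N| = m.+1)%N -> has_dim (tight_face N) k.
Proof.
move=> KN kN; have [k' dk' k'N] := K_dim KN.
by have -> : k = k' by move: kN k'N; lia.
Qed.

Lemma system_dim : has_dim P m.
Proof.
have -> : P = tight_face [set t]%SET.
  apply/seteqP; split=> [x Px|x []//]; split=> //.
  by rewrite finset.sub1set; apply/K_mem/K_tight.
by apply: tight_face_dim K_base _; rewrite cards1 addn1.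
Qed.

Lemma facet_tight_face i : i != t -> K [set t; i]%SET ->
  facet P (tight_face [set t; i]%SET).
Proof.
move=> it Ki; have [x Px xN] := K_attained Ki.
split.
  by apply: tight_face_face; rewrite -xN; apply/fintype.subsetP => j /tightP[].
have [k dk] := K_dim Ki; rewrite cards2 eq_sym it => km.
exists k; split=> //; have -> : (k + 1 = m)%N by move: km; lia.
exact: system_dim.
Qed.

Lemma facetE G : facet P G ->
  exists i, [/\ i != t, K [set t; i]%SET & G = tight_face [set t; i]%SET].
Proof.
move=> [fG [k [dG dP]]].
have G0 : G !=set0 by have [x [U [Gx _ _ _]]] := dG; exists x.
have [x Gx GE] := face_tight_face fG G0.
have Kx : K (tight x) by apply: K_tight; move: Gx; rewrite GE => -[].
have [k' dk'] := K_dim Kx; rewrite -GE in dk'.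
have <- := has_dim_unique dG dk'; have <- := has_dim_unique dP system_dim.
move=> card2.
have /cards1P[i iE] : #|tight x :\ t| == 1%N.
  have := cardsD1 t (tight x); rewrite K_mem // => tE.
  by apply/eqP; move: card2 tE; lia.
have tE : tight x = [set t; i]%SET by rewrite -iE finset.setD1K // K_mem.
exists i; rewrite -tE; split=> //.
by have := set11 i; rewrite -iE !inE => /andP[].
Qed.

Lemma vertex_card_tight v : vertex P v -> #|tight v| = m.+1.
Proof.
move=> fv; have [Pv _] := vertex_rigid fv.
have [|x /= -> vE] := face_tight_face fv; first by exists v.
have [k dk <-] := K_dim (K_tight Pv); rewrite -vE in dk.
suff /has_dim_unique/(_ dk) <- : has_dim [set v] 0 by [].
exists v, 0%VS; split=> //; first by rewrite dimv0.
- by move=> y ->; rewrite subrr mem0v.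
- by move=> W _; apply: sub0v.
Qed.

(** A vertex has [m] tight inequalities besides the base one, and by [K_down]
    each of them alone cuts out a facet through the vertex. *)
Lemma system_simple : is_simple P.
Proof.
exists m; first exact: system_dim.
move=> v fv; have [Pv _] := vertex_rigid fv; have Kv := K_tight Pv.
have tv := K_mem Kv.
have <- : #|tight v :\ t| = m.
  by have := vertex_card_tight fv; rewrite (cardsD1 t) tv => -[].
have K2 i : i \in tight v -> K [set t; i]%SET.
  move=> iv; apply: K_down Kv _ _; first by rewrite !inE eqxx.
  by rewrite finset.subUset !finset.sub1set tv.
have -> : [set F | facet P F /\ F v] =
    (fun i => tight_face [set t; i]%SET) @` [set i | i \in tight v :\ t].
  apply/seteqP; split=> [F [/facetE[i [it _ ->]] [_ iv]]|_ [i /= iv <-]].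
    exists i => //=; rewrite finset.in_setD1 it /=.
    by apply: (fintype.subsetP iv); rewrite !inE eqxx orbT.
  move: iv; rewrite finset.in_setD1 => /andP[it iv].
  split; first by apply: facet_tight_face => //; apply: K2.
  by split=> //; rewrite finset.subUset !finset.sub1set tv.
apply: card_eq_trans (card_set_finset _); apply: inj_card_eq => i j.
rewrite !inE /= !finset.in_setD1 => /andP[it iv] /andP[jt jv] ijE.
have [x Px xi] := K_attained (K2 i iv).
have : tight_face [set t; i]%SET x by split; rewrite ?xi.
rewrite ijE => -[_]; rewrite xi => /fintype.subsetP/(_ j).
by rewrite !inE eqxx orbT (negPf jt) => /(_ isT)/eqP.
Qed.

End ComplexOfSystem.

(** * Nested families of a building set *)

Section Nested.
Variable n : nat.
Local Notation V := 'I_n.+1.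
Local Notation top := [set: V]%SET.
Local Notation cover := finset.cover.
Implicit Types (B N M : {set {set V}}) (S T U : {set V}).

(** Equivalently, members are pairwise comparable or disjoint and no union of
    two or more pairwise disjoint members lies in [B].  The ground set is
    kept in every family: it indexes the equation of the affine hull. *)
Definition nested B N : Prop :=
  [/\ N \subset B, top \in N
    & forall M, M \subset N -> M != finset.set0 ->
        cover M \in B -> cover M \in M].

Lemma nested_sub B N M : nested B N -> top \in M -> M \subset N -> nested B M.
Proof.
move=> [NB _ cN] tM MN; split=> // [|L LM]; first exact: fintype.subset_trans NB.
by apply: cN; apply: fintype.subset_trans MN.
Qed.

Lemma cover_sup M S : S \in M -> S \subset cover M.
Proof. by move=> SM; apply: (finset.bigcup_sup S). Qed.

Lemma cover_subP M U : reflect (forall S, S \in M -> S \subset U) (cover M \subset U).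
Proof. exact: finset.bigcupsP. Qed.

Lemma mem_cover M i : reflect (exists2 S, S \in M & i \in S) (i \in cover M).
Proof. exact: finset.bigcupP. Qed.

Lemma cover_set2 S T : cover [set S; T]%SET = S :|: T.
Proof.
have [->|ST] := eqVneq S T; first by rewrite finset.setUid finset.setUid cover1.
by rewrite /cover big_setU1 ?inE //= big_set1.
Qed.

Lemma nested_add_top B N : top \in B -> N \subset B ->
    (forall M, M \subset N -> M != finset.set0 ->
        cover M \in B -> cover M \in M) ->
  nested B (top |: N).
Proof.
move=> tB NB cN; split=> [||M MN M0 cM].
- by rewrite finset.subUset finset.sub1set tB.
- by rewrite !inE eqxx.
have [tM|tM] := boolP (top \in M).
  suff -> : cover M = top by [].
  by apply/eqP; rewrite -finset.subTset cover_sup.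
apply: cN => //; apply/fintype.subsetP => S SM.
have := fintype.subsetP MN _ SM; rewrite !inE => /predU1P[ST|//].
by rewrite -ST SM in tM.
Qed.

Lemma nested_top B : top \in B -> nested B [set top]%SET.
Proof.
move=> tB; rewrite -[[set top]%SET]finset.setU0; apply: nested_add_top => //.
  exact: finset.sub0set.
by move=> M; rewrite finset.subset0 => /eqP ->; rewrite eqxx.
Qed.

Lemma nested1 B S : top \in B -> S \in B -> nested B [set top; S]%SET.
Proof.
move=> tB SB; apply: nested_add_top => //; first by rewrite finset.sub1set.
move=> M; rewrite finset.subset1 => /orP[/eqP -> _ _|/eqP ->].
  by rewrite cover1 !inE.
by rewrite eqxx.
Qed.

Lemma nested2 B S T : top \in B -> S \in B -> T \in B -> S :|: T \notin B ->
  nested B (top |: [set S; T]%SET).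
Proof.
move=> tB SB TB STB; apply: nested_add_top => //.
  by rewrite finset.subUset !finset.sub1set SB.
move=> M MN M0 cM; have MS : M :\ T \subset [set S]%SET.
  apply/fintype.subsetP => U; rewrite in_setD1 => /andP[UT /(fintype.subsetP MN)].
  by rewrite !inE (negPf UT) orbF.
have [TM|TM] := boolP (T \in M); last first.
  move: MS; rewrite finset.subset1.
  have -> : M :\ T = M.
    by apply/setP => U; rewrite !inE; case: eqVneq => // ->; rewrite (negPf TM).
  by rewrite (negPf M0) orbF => /eqP ->; rewrite cover1 !inE.
move: MS; rewrite finset.subset1 => /orP[|]/eqP ME.
  have ME' : M = [set S; T]%SET by rewrite -(finset.setD1K TM) ME finset.setUC.
  by rewrite ME' cover_set2 (negPf STB) in cM.
have -> : M = [set T]%SET by rewrite -(finset.setD1K TM) ME finset.setU0.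
by rewrite cover1 !inE.
Qed.

Lemma building_neq0 B S : building_set B -> S \in B -> S != finset.set0.
Proof. by move=> [B0 _ _] SB; apply: contraNneq B0 => <-. Qed.

Lemma building_cover B T M : building_set B -> T \in B -> M \subset B ->
  (forall S, S \in M -> S :&: T != finset.set0) -> T :|: cover M \in B.
Proof.
move=> bB TB; have [_ _ BU] := bB.
move Ek : #|M| => k; elim: k M Ek => [|k IH] M Mk MB MT.
  by rewrite (cards0_eq Mk) /cover big_set0 finset.setU0.
have [S SM] : exists S, S \in M by apply/set0Pn; rewrite -card_gt0 Mk.
have Mk' : #|M :\ S| = k by move: Mk; rewrite (cardsD1 S) SM add1n => -[].
have MS : M :\ S \subset M by apply: finset.subD1set.
have := IH _ Mk' (fintype.subset_trans MS MB)
  (fun U UM => MT U (fintype.subsetP MS U UM)).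
have -> : cover M = S :|: cover (M :\ S) by rewrite /cover (big_setD1 S).
move=> /(BU S _ (fintype.subsetP MB _ SM)) H.
rewrite finset.setUCA; apply: H; have /set0Pn[i] := MT S SM.
by rewrite inE => /andP[iS iT]; apply/set0Pn; exists i; rewrite !inE iS iT.
Qed.

Section OneNested.
Variables (B N : {set {set V}}).
Hypotheses (bB : building_set B) (nN : nested B N).

Lemma nested_mem S : S \in N -> S \in B.
Proof. by have [/fintype.subsetP NB _ _] := nN; apply: NB. Qed.

Lemma nested_comparable S T : S \in N -> T \in N -> S :&: T != finset.set0 ->
  S \subset T \/ T \subset S.
Proof.
move=> SN TN ST; have [_ _ cN] := nN; have [_ _ BU] := bB.
have := cN [set S; T]%SET; rewrite finset.subUset !finset.sub1set SN TN.
have -> : [set S; T]%SET != finset.set0.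
  by apply/set0Pn; exists S; rewrite !inE eqxx.
rewrite cover_set2 BU ?nested_mem // => /(_ isT isT isT).
rewrite !inE => /orP[]/eqP <-; [right|left]; first exact: finset.subsetUr.
exact: finset.subsetUl.
Qed.

(** For nonempty [T] the members above [T] form a chain, so that the smallest
    cardinality gives the least member. *)
Definition carrier T : {set V} :=
  [arg min_(S < top | (S \in N) && (T \subset S)) #|S|].

Definition cell S : {set V} := S :\: cover [set S' in N | S' \proper S]%SET.

Lemma carrierP T : T != finset.set0 ->
  [/\ carrier T \in N, T \subset carrier T
    & forall S, S \in N -> T \subset S -> carrier T \subset S].
Proof.
have [_ tN _] := nN; move=> T0; rewrite /carrier.
case: arg_minnP => [|S /andP[SN TS] Smin]; first by rewrite tN finset.subsetT.
split=> // S' S'N TS'.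
have SS'0 : S :&: S' != finset.set0.
  have /set0Pn[i iT] := T0; apply/set0Pn; exists i.
  by rewrite inE (fintype.subsetP TS) // (fintype.subsetP TS').
have [//|S'S] := nested_comparable SN S'N SS'0.
have /eqP -> : S' == S by rewrite eqEcard S'S Smin // S'N.
exact: fintype.subxx.
Qed.

Lemma carrier_id S : S \in N -> carrier S = S.
Proof.
move=> SN; have [_ SS] := carrierP (building_neq0 bB (nested_mem SN)).
by move=> /(_ S SN (fintype.subxx _)) cS; apply/eqP; rewrite finset.eqEsubset cS.
Qed.

Lemma cell_sub S T i : S \in N -> T \in N -> i \in cell S -> i \in T -> S \subset T.
Proof.
move=> SN TN; rewrite inE => /andP[/mem_cover ic iS] iT.
have ST0 : S :&: T != finset.set0 by apply/set0Pn; exists i; rewrite inE iS.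
have [//|TS] := nested_comparable SN TN ST0.
apply: contraT => ST; case: ic; exists T => //.
by rewrite inE TN properE TS.
Qed.

(** If [T] missed the cell of its carrier it would be covered by smaller members
    of the family that meet it; their union would belong to [B], hence to the
    family, and contain [T], against minimality of the carrier. *)
Lemma meet_cell T : T \in B -> T :&: cell (carrier T) != finset.set0.
Proof.
move=> TB; have T0 := building_neq0 bB TB.
have [cN Tc cmin] := carrierP T0; apply/negP => /eqP Tcell.
pose M := [set S in N | (S \proper carrier T) && (S :&: T != finset.set0)]%SET.
have TM : T \subset cover M.
  apply/fintype.subsetP => i iT; have : i \notin T :&: cell (carrier T).
    by rewrite Tcell inE.
  rewrite inE iT inE (fintype.subsetP Tc) // andbT negbK => /mem_cover[S].
  rewrite inE => /andP[SN Sc] iS; apply/mem_cover; exists S => //.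
  by rewrite inE SN Sc; apply/set0Pn; exists i; rewrite inE iS.
have MN : M \subset N by apply/fintype.subsetP => S; rewrite inE => /andP[].
have [NB _ cnN] := nN.
have M0 : M != finset.set0.
  have /set0Pn[i /(fintype.subsetP TM)/mem_cover[S SM _]] := T0.
  by apply/set0Pn; exists S.
have : cover M \in M.
  apply: cnN => //; have /finset.setUidPr <- := TM.
  apply: building_cover => //; first exact: fintype.subset_trans NB.
  by move=> S; rewrite inE => /and3P[].
rewrite inE => /and3P[cM]; rewrite properE => /andP[_ /negP nc] _.
by apply: nc; apply: cmin.
Qed.

Lemma cell_neq0 S : S \in N -> cell S != finset.set0.
Proof.
move=> SN; have /set0Pn[i] := meet_cell (nested_mem SN).
by rewrite carrier_id // inE => /andP[_ iS]; apply/set0Pn; exists i.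
Qed.

End OneNested.
End Nested.

(** * Splitting members and adjoining unions *)

Section Splitting.
Variable n : nat.
Local Notation V := 'I_n.+1.
Local Notation top := [set: V]%SET.
Local Notation cover := finset.cover.
Implicit Types (B N M : {set {set V}}) (S T U : {set V}).

Definition splits B S : Prop :=
  exists S1 S2, [/\ S1 \in B, S2 \in B, S1 :&: S2 = finset.set0 & S1 :|: S2 = S].

Lemma splits_ltn B S S1 S2 : building_set B -> S1 \in B -> S2 \in B ->
  S1 :&: S2 = finset.set0 -> S1 :|: S2 = S -> (#|S1| < #|S|)%N /\ (#|S2| < #|S|)%N.
Proof.
move=> bB /(building_neq0 bB) S1_0 /(building_neq0 bB) S2_0 S12 <-.
rewrite cardsU S12 cards0 subn0; rewrite -!card_gt0 in S1_0 S2_0.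
by split; move: S1_0 S2_0; lia.
Qed.

Lemma card_gt1_notin B S : building_set B -> S != finset.set0 -> S \notin B ->
  (1 < #|S|)%N.
Proof.
move=> [_ B1 _] S0 SB; rewrite ltn_neqAle card_gt0 S0 andbT eq_sym.
by apply: contra SB => /cards1P[i ->].
Qed.

(** Among the disjoint pairs of members of [B] whose union is new, a pair with
    the largest union can be adjoined alone: a member of [B] meeting both parts
    absorbs them, and one meeting a single part would enlarge the pair. *)
Lemma exists_adjunction B C : connected_building_set B ->
    building_set C -> B \proper C ->
    (forall S, S \in C -> (1 < #|S|)%N -> splits C S) ->
  exists S T, [/\ S \in B, T \in B, S :&: T = finset.set0, S :|: T \in C :\: B
    & building_set (S :|: T |: B)].
Proof.
move=> [bB tB] bC /properP[BC [S0 S0C S0B]] Csplits.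
have [_ _ BU] := bB; have [_ _ CU] := bC.
pose new := fun p : {set V} * {set V} => [&& p.1 \in B, p.2 \in B,
  p.1 :&: p.2 == finset.set0 & p.1 :|: p.2 \in C :\: B].
have [p0 p0new] : exists p, new p.
  pose fresh S := (S \in C) && (S \notin B).
  have S0CB : fresh S0 by rewrite /fresh S0C.
  case: (arg_minnP (fun S => #|S|) S0CB) => S /andP[SC SB] Smin.
  have [|S1 [S2 [S1C S2C S12 SE]]] := Csplits S SC.
    exact: card_gt1_notin bB (building_neq0 bC SC) SB.
  have [lt1 lt2] := splits_ltn bC S1C S2C S12 SE.
  have inB U : U \in C -> (#|U| < #|S|)%N -> U \in B.
    move=> UC; apply: contraLR => UB; rewrite -leqNgt; apply: Smin.
    by rewrite /fresh UB UC.
  by exists (S1, S2); rewrite /new /= !inB // S12 eqxx SE inE SB.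
case: (arg_maxnP (fun p : {set V} * {set V} => #|p.1 :|: p.2|) p0new).
move=> [S T] /and4P[/= SB TB /eqP ST STn] STmax; exists S, T; split=> //.
have [STB STC] : S :|: T \notin B /\ S :|: T \in C.
  by move: STn; rewrite inE => /andP[].
have key S' T' U : S' \in B -> T' \in B -> S' :&: T' = finset.set0 ->
    S' :|: T' = S :|: T -> U \in B -> U :&: S' != finset.set0 ->
    U :|: (S :|: T) \in S :|: T |: B.
  move=> S'B T'B ST' E UB US'; rewrite !inE.
  have US'B : U :|: S' \in B by apply: BU.
  have [UT'|UT'] := eqVneq (U :&: T') finset.set0; last first.
    rewrite -E finset.setUA BU ?orbT //.
    have /set0Pn[i] := UT'; rewrite inE => /andP[iU iT'].
    by apply/set0Pn; exists i; rewrite !inE iU iT'.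
  have [|UB'] := boolP (U :|: (S :|: T) \in B); rewrite ?orbT // orbF.
  have : new (U :|: S', T').
    rewrite /new /= US'B T'B finset.setIUl UT' ST' finset.setU0 eqxx /=.
    rewrite -finset.setUA E inE UB' /=; apply: CU => //.
      exact: (fintype.subsetP BC).
    have /set0Pn[i] := US'; rewrite inE => /andP[iU iS'].
    by apply/set0Pn; exists i; rewrite inE iU -E inE iS'.
  move=> /STmax /=; rewrite -finset.setUA E => le.
  by rewrite eq_sym eqEcard finset.subsetUr.
have adj U : U \in B -> U :&: (S :|: T) != finset.set0 ->
    U :|: (S :|: T) \in S :|: T |: B.
  move=> UB /set0Pn[i /finset.setIP[iU /finset.setUP[iS|iT]]].
    by apply: (key S T) => //; apply/set0Pn; exists i; rewrite inE iU.
  apply: (key T S) => //; rewrite 1?finset.setIC 1?finset.setUC //.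
  by apply/set0Pn; exists i; rewrite inE iT.
split=> [|i|U W].
- rewrite !inE negb_or; have [-> _ _] := bB; rewrite andbT.
  by rewrite eq_sym (building_neq0 bC).
- by rewrite !inE; have [_ -> _] := bB; rewrite orbT.
rewrite [U \in _]inE [W \in _]inE !inE.
move=> /predU1P[->|UB] /predU1P[->|WB] UW.
- by rewrite finset.setUid eqxx.
- by rewrite finset.setUC; have := adj W WB; rewrite !inE finset.setIC; apply.
- by have := adj U UB; rewrite !inE; apply.
- by rewrite BU ?orbT.
Qed.

(** A subfamily of [N] whose union is [S :|: T] has each member inside [S] or
    inside [T], by maximality of these two in [B]; it then covers [S] and [T]
    separately, so that both belong to [N]. *)
Lemma nested_adjoin B N S T : building_set B -> S \in B -> T \in B ->
    S :&: T = finset.set0 -> S :|: T \notin B ->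
    nested B N -> ~~ ([set S; T]%SET \subset N) ->
  nested (S :|: T |: B) N.
Proof.
move=> bB SB TB ST STB nN; have [NB tN cN] := nN; have [_ _ BU] := bB.
have part S' T' M : S' \in B -> T' \in B -> S' :&: T' = finset.set0 ->
    S' :|: T' = S :|: T -> M \subset N -> cover M = S :|: T -> S' \in N.
  move=> S'B T'B ST' E MN cM; pose M' := [set U in M | U \subset S']%SET.
  have MB : M \subset B := fintype.subset_trans MN NB.
  have cM' : cover M' = S'.
    apply/eqP; rewrite finset.eqEsubset; apply/andP; split.
      by apply/cover_subP => U; rewrite inE => /andP[].
    apply/fintype.subsetP => i iS'.
    have : i \in cover M by rewrite cM -E inE iS'.
    move=> /mem_cover[U UM iU]; apply/mem_cover; exists U => //; rewrite inE UM.
    have UST : U \subset S' :|: T' by rewrite E -cM cover_sup.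
    apply: contraNT STB => US'.
    have UT : (U :|: S') :&: T' != finset.set0.
      have /subsetPn[j jU jS'] := US'; apply/set0Pn; exists j.
      by have := fintype.subsetP UST j jU; rewrite !inE jU (negPf jS').
    have US0 : U :&: S' != finset.set0 by apply/set0Pn; exists i; rewrite inE iU.
    have : U :|: S' :|: T' \in B by rewrite !BU // (fintype.subsetP MB).
    by rewrite -finset.setUA; have /finset.setUidPr -> := UST; rewrite E.
  have M'M : M' \subset M by apply/fintype.subsetP => U; rewrite inE => /andP[].
  have M'N := fintype.subset_trans M'M MN.
  have M'0 : M' != finset.set0.
    apply: contraNneq (building_neq0 bB S'B) => M'0.
    by rewrite -cM' M'0 /cover big_set0.
  by have := cN M' M'N M'0; rewrite cM' => /(_ S'B); apply: (fintype.subsetP M'N).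
move=> STN; split=> // [|M MN M0].
  by apply: fintype.subset_trans NB _; apply: finset.subsetUr.
rewrite !inE => /predU1P[cM|]; last exact: cN.
case/negP: STN; rewrite finset.subUset !finset.sub1set.
rewrite (part S T M) // (part T S M) // 1?finset.setIC // finset.setUC //.
Qed.

(** A member [S] of [B] that does not split is the union of pairwise disjoint
    smaller members no two of which have their union in [B]: a largest proper
    one, [T], and the maximal ones inside the rest. *)
Lemma splits_or_cover B S : connected_building_set B -> S \in B ->
    (1 < #|S|)%N -> ~ splits B S ->
  exists M, [/\ M \subset B, M != finset.set0, cover M = S, S \notin M
    & forall U W, U \in M -> W \in M -> U != W ->
        U :&: W = finset.set0 /\ U :|: W \notin B].
Proof.
move=> [bB tB] SB S1 nS; have [_ B1 BU] := bB.
have [i0 i0S] : exists i, i \in S by apply/set0Pn; rewrite -card_gt0 ltnW.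
pose below U := (U \in B) && (U \proper S).
have below1 i : i \in S -> below [set i]%SET.
  move=> iS; rewrite /below B1 properEcard finset.sub1set iS cards1.
  exact: S1.
case: (arg_maxnP (fun U => #|U|) (below1 _ i0S)) => T /andP[TB TS] Tmax.
pose inside U := (U \in B) && (U \subset S :\: T).
pose C := [set U | maxset inside U]%SET.
have CP U : U \in C -> U \in B /\ U \subset S :\: T.
  by rewrite inE => /maxsetp/andP[].
have Cmax U W : U \in C -> W \in B -> W \subset S :\: T -> U \subset W -> W = U.
  rewrite inE => /maxsetP[_ Umax] WB WS UW.
  by apply: Umax => //; rewrite /inside WB.
have Cpair U W : U \in C -> W \in C -> U != W -> U :|: W \notin B.
  move=> UC WC; apply: contraNN => UWB; have [_ US] := CP _ UC.
  have [_ WS] := CP _ WC.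
  have UWS : U :|: W \subset S :\: T by rewrite finset.subUset US.
  have EU := Cmax _ _ UC UWB UWS (finset.subsetUl _ _).
  have EW := Cmax _ _ WC UWB UWS (finset.subsetUr _ _).
  by rewrite -[X in X == _]EU EW eqxx.
have Cdisj U W : U \in C -> W \in C -> U != W -> U :&: W = finset.set0.
  move=> UC WC UW; apply: contraNeq (Cpair _ _ UC WC UW) => UW0.
  by have [[UB _] [WB _]] := (CP _ UC, CP _ WC); apply: BU.
have TC U : U \in C -> U :&: T = finset.set0 /\ U :|: T \notin B.
  move=> UC; have [UB US] := CP _ UC.
  have UT : U :&: T = finset.set0.
    apply/setP => i; rewrite !inE; apply/negP => /andP[/(fintype.subsetP US)].
    by rewrite inE => /andP[/negPf ->].
  split=> //; apply/negP => UTB; apply: nS.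
  have UTS : U :|: T \subset S.
    rewrite finset.subUset (proper_sub TS) andbT.
    by apply: fintype.subset_trans US _; apply: finset.subsetDl.
  have [E|UTn] := eqVneq (U :|: T) S; first by exists U, T.
  have := Tmax (U :|: T); rewrite /below UTB finset.properEneq UTn UTS.
  move=> /(_ isT) /=; rewrite cardsU UT cards0 subn0 -[X in (_ <= X)%N]add0n.
  by rewrite leq_add2r leqn0 cards_eq0 (negPf (building_neq0 bB UB)).
have cM : cover (T |: C) = S.
  apply/eqP; rewrite finset.eqEsubset; apply/andP; split.
    apply/cover_subP => U; rewrite 2!inE => /predU1P[->|UC].
      exact: proper_sub.
    have [_ US] := CP U UC.
    by apply: fintype.subset_trans US _; apply: finset.subsetDl.
  apply/fintype.subsetP => i iS; apply/mem_cover.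
  have [iT|iT] := boolP (i \in T); first by exists T; rewrite // !inE eqxx.
  have [|U Umax iU] := @maxset_exists _ inside [set i]%SET.
    by rewrite /inside B1 finset.sub1set inE iT.
  by exists U; [rewrite !inE Umax orbT|rewrite -finset.sub1set].
exists (T |: C); split=> //.
- rewrite finset.subUset finset.sub1set TB; apply/fintype.subsetP => U /CP[].
  by [].
- by apply/set0Pn; exists T; rewrite !inE eqxx.
- apply/negP; rewrite 2!inE => /predU1P[E|/CP[_ SST]].
    by move: TS; rewrite -E fintype.properxx.
  have /set0Pn[j jT] := building_neq0 bB TB.
  have := fintype.subsetP SST j (fintype.subsetP (proper_sub TS) j jT).
  by rewrite inE jT.
- move=> U W; rewrite 2!inE => /predU1P[->|UC]; rewrite 2!inE => /predU1P[->|WC].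
  + by rewrite eqxx.
  + by have [? ?] := TC _ WC; rewrite finset.setIC finset.setUC.
  + by have [? ?] := TC _ UC.
  + by split; [apply: Cdisj|apply: Cpair].
Qed.

End Splitting.

(** * Weighted nestohedra *)

Section Weighted.
Variables (R : realType) (n : nat).
Local Notation V := 'I_n.+1.
Local Notation top := [set: V]%SET.
Local Notation cover := finset.cover.
Implicit Types (S T U W : {set V}) (N M : {set {set V}}) (x : 'rV[R]_n.+1).

Definition charv S : 'rV[R]_n.+1 := \row_j (j \in S)%:R.

Lemma dot_charv S x : dot (charv S) x = \sum_(j in S) x 0 j.
Proof.
rewrite /dot [RHS]big_mkcond; apply: eq_bigr => j _.
by rewrite mxE; case: ifP; rewrite ?mul1r ?mul0r.
Qed.

Lemma dot_charv_delta S j : dot (charv S) (delta_mx 0 j) = (j \in S)%:R.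
Proof.
rewrite dot_charv; under eq_bigr do rewrite mxE eqxx /=.
have [jS|jS] := boolP (j \in S).
  by rewrite (bigD1 j) //= eqxx big1 ?addr0 // => i /andP[_ /negPf ->].
by rewrite big1 // => i iS; case: eqVneq => // ij; rewrite -ij iS in jS.
Qed.

Lemma dot_charvUI S T x :
  dot (charv (S :|: T)) x + dot (charv (S :&: T)) x =
  dot (charv S) x + dot (charv T) x.
Proof.
rewrite /dot -!big_split; apply: eq_bigr => j _; rewrite /= !mxE !inE.
by case: (j \in S); case: (j \in T); rewrite /= ?mul1r ?mul0r ?addr0 ?add0r.
Qed.

Variables (B : {set {set V}}) (lam : {set V} -> R).
Hypothesis cB : connected_building_set B.
Hypothesis lam_gt0 : forall S, S \in B -> 0 < lam S.

Let bB : building_set B. Proof. by have [] := cB. Qed.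
Let tB : top \in B. Proof. by have [] := cB. Qed.

Definition bound U : R := \sum_(T in B) lam T * (T \subset U)%:R.

(** For positive weights this is the Minkowski sum of the simplices on the members
    [S] of [B], scaled by [lam S]. *)
Definition weighted : set 'rV[R]_n.+1 :=
  solutions charv bound B [set top]%SET.

Local Notation tight := (tight charv bound B).

Lemma bound0 : bound finset.set0 = 0.
Proof.
rewrite /bound big1 // => T TB; rewrite finset.subset0.
by rewrite (negPf (building_neq0 bB TB)) mulr0.
Qed.

(** The inequalities for the members of [B] imply those for all subsets: a
    maximal member [T] inside [U] is disjoint from any other member inside [U]
    that it does not contain, so both sides are additive on [T] and its
    complement in [U]. *)
Lemma bound_le U x : weighted x -> bound U <= dot (charv U) x.
Proof.
move=> Px; have [k] := ubnP #|U|; elim: k U => // k IH U; rewrite ltnS => Uk.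
have [->|/set0Pn[i iU]] := eqVneq U finset.set0.
  by rewrite bound0 dot_charv big_set0.
pose inside T := (T \in B) && (T \subset U).
have [_ B1 BU] := bB.
have [|T Tmax iT] := @maxset_exists _ inside [set i]%SET.
  by rewrite /inside B1 finset.sub1set.
have /andP[TB TU] := maxsetp Tmax.
have T0 := building_neq0 bB TB.
have -> : bound U = bound T + bound (U :\: T).
  rewrite /bound -big_split; apply: eq_bigr => W WB /=.
  rewrite -mulrDr; congr (_ * _).
  rewrite finset.subsetD -finset.setI_eq0.
  have [WT|WT] := boolP (W \subset T).
    rewrite (fintype.subset_trans WT TU); have /finset.setIidPl -> := WT.
    by rewrite (negPf (building_neq0 bB WB)) andbF addr0.
  rewrite add0r; have [WU|//] := boolP (W \subset U).
  suff -> : W :&: T == finset.set0 by [].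
  apply: contraNT WT => WT0.
  have UB : inside (W :|: T) by rewrite /inside BU // finset.subUset WU.
  have /maxsetP[_ /(_ _ UB (finset.subsetUr _ _)) <-] := Tmax.
  exact: finset.subsetUl.
have <- : dot (charv T) x + dot (charv (U :\: T)) x = dot (charv U) x.
  rewrite -dot_charvUI.
  have -> : T :|: (U :\: T) = U.
    by have /finset.setIidPr UT := TU; rewrite -[X in X :|: _]UT finset.setID.
  have -> : T :&: (U :\: T) = finset.set0.
    by apply/setP => j; rewrite !inE; case: (j \in T).
  by rewrite [X in _ + X]dot_charv big_set0 addr0.
apply: lerD; first by have [] := Px T TB.
apply: IH; apply: leq_trans Uk; rewrite -(cardsID T U) -[X in (X < _)%N]add0n.
have /finset.setIidPr -> := TU.
by rewrite ltn_add2r card_gt0.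
Qed.

(** The bounds of the union and the intersection together exceed those of [S]
    and [T] by the weight of the members of [B] inside the union and inside
    neither [S] nor [T]; tightness leaves no room for this excess. *)
Lemma uncross S T x : weighted x ->
    dot (charv S) x = bound S -> dot (charv T) x = bound T ->
  dot (charv (S :|: T)) x = bound (S :|: T) /\
  forall W, W \in B -> W \subset S :|: T -> W \subset S \/ W \subset T.
Proof.
move=> Px xS xT.
pose gap W := lam W * [&& W \subset S :|: T, ~~ (W \subset S) & ~~ (W \subset T)]%:R.
have gap_ge0 W : W \in B -> 0 <= gap W.
  by move=> WB; rewrite mulr_ge0 ?ler0n // ltW ?lam_gt0.
have gapE : bound (S :|: T) + bound (S :&: T) =
    bound S + bound T + \sum_(W in B) gap W.
  rewrite /bound -!big_split; apply: eq_bigr => W WB /=.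
  rewrite -!mulrDr; congr (_ * _); rewrite finset.subsetI.
  have [WS|WS] := boolP (W \subset S).
    rewrite (fintype.subset_trans WS (finset.subsetUl _ _)) /=.
    by rewrite addr0.
  have [WT|WT] := boolP (W \subset T).
    by rewrite (fintype.subset_trans WT (finset.subsetUr _ _)) /= !addr0 add0r.
  by rewrite /= andbT addr0 !add0r.
have := dot_charvUI S T x; rewrite xS xT.
have := bound_le (S :|: T) Px; have := bound_le (S :&: T) Px.
have : 0 <= \sum_(W in B) gap W by apply: sumr_ge0.
move=> g0 leI leU E; split; first by lra.
have : \sum_(W in B) gap W == 0 by apply/eqP; lra.
rewrite psumr_eq0 => [/allP gap0 W WB WST|W /gap_ge0 //].
have := gap0 W (mem_index_enum _).
rewrite WB /gap WST mulf_eq0 gt_eqF ?lam_gt0 //= pnatr_eq0 eqb0 negb_and !negbK.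
by move=> /orP.
Qed.

Lemma tight_cover M x : weighted x -> M \subset tight x ->
  dot (charv (cover M)) x = bound (cover M) /\
  forall W, W \in B -> W \subset cover M -> exists2 S, S \in M & W \subset S.
Proof.
move=> Px; move Ek : #|M| => k; elim: k M Ek => [|k IH] M Mk Mx.
  rewrite (cards0_eq Mk) /cover big_set0 bound0 dot_charv big_set0; split=> // W.
  by move=> /(building_neq0 bB) W0; rewrite finset.subset0 (negPf W0).
have [S SM] : exists S, S \in M by apply/set0Pn; rewrite -card_gt0 Mk.
have Mk' : #|M :\ S| = k by move: Mk; rewrite (cardsD1 S) SM add1n => -[].
have MS : M :\ S \subset M by apply: finset.subD1set.
have [xM subM] := IH _ Mk' (fintype.subset_trans MS Mx).
have /tightP[SB xS] := fintype.subsetP Mx _ SM.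
have -> : cover M = S :|: cover (M :\ S) by rewrite /cover (big_setD1 S).
have [xU subU] := uncross Px xS xM.
split=> // W WB /(subU W WB)[WS|/(subM W WB)[U UM WU]]; first by exists S.
by exists U => //; apply: (fintype.subsetP MS).
Qed.

(** A member of [B] covered by tight sets lies inside one of them. *)
Lemma weighted_nested x : weighted x -> nested B (tight x).
Proof.
move=> Px; split=> [||M Mx M0 cM].
- by apply/fintype.subsetP => S /tightP[].
- by apply/tightP; split=> //; have [_ -> //] := Px _ tB; rewrite !inE.
have [_ /(_ _ cM (fintype.subxx _))[S SM cS]] := tight_cover Px Mx.
suff -> : cover M = S by [].
by apply/eqP; rewrite finset.eqEsubset cS cover_sup.
Qed.

(** The point of the face of [N] in which each simplex contributes the
    barycentre of its part in the cell of its carrier. *)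
Definition spread N T : 'rV[R]_n.+1 :=
  let J := T :&: cell N (carrier N T) in
  #|J|%:R^-1 *: \sum_(j in J) delta_mx 0 j.

Lemma dot_spread N T U : dot (charv U) (spread N T) =
  #|T :&: cell N (carrier N T) :&: U|%:R / #|T :&: cell N (carrier N T)|%:R.
Proof.
rewrite /spread linearZ linear_sum /= mulrC; congr (_ * _).
under eq_bigr do rewrite dot_charv_delta.
rewrite -natr_sum -sum1_card; congr _%:R; rewrite [RHS]big_mkcond [LHS]big_mkcond.
by apply: eq_bigr => j _; rewrite [in RHS]inE; case: (j \in _ :&: _); case: (j \in U).
Qed.

Definition spread_sum N : 'rV[R]_n.+1 := \sum_(T in B) lam T *: spread N T.

Lemma dot_spread_sum N U :
  dot (charv U) (spread_sum N) = \sum_(T in B) lam T * dot (charv U) (spread N T).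
Proof. by rewrite linear_sum; apply: eq_bigr => T _; rewrite linearZ. Qed.

Section OneFace.
Variable N : {set {set V}}.
Hypothesis nN : nested B N.

Let J T := T :&: cell N (carrier N T).

Let J_gt0 T : T \in B -> 0 < #|J T|%:R :> R.
Proof. by move=> TB; rewrite ltr0n card_gt0 (meet_cell bB nN). Qed.

Lemma dot_spread_ge T U : T \in B -> (T \subset U)%:R <= dot (charv U) (spread N T).
Proof.
move=> TB; rewrite dot_spread -/(J T).
have [TU|TU] := boolP (T \subset U); last by rewrite mulr_ge0 ?invr_ge0 ?ler0n.
have /finset.setIidPl -> : J T \subset U.
  by apply: fintype.subset_trans TU; apply: finset.subsetIl.
by rewrite divff ?gt_eqF ?J_gt0.
Qed.

Lemma dot_spread_mem T S : T \in B -> S \in N ->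
  dot (charv S) (spread N T) = (T \subset S)%:R.
Proof.
move=> TB SN; have [TS|TS] := boolP (T \subset S).
  apply/eqP; rewrite eq_le; have := dot_spread_ge S TB; rewrite TS => ->.
  rewrite andbT dot_spread -/(J T) ler_pdivrMr ?J_gt0 // mul1r ler_nat.
  by rewrite subset_leq_card // finset.subsetIl.
have [cN Tc cmin] := carrierP bB nN (building_neq0 bB TB).
rewrite dot_spread -/(J T) (_ : J T :&: S = finset.set0) ?cards0 ?mul0r //.
apply/setP => j; rewrite [RHS]inE; apply/negP.
move=> /finset.setIP[/finset.setIP[jT jc] jS]; case/negP: TS.
exact: fintype.subset_trans Tc (cell_sub bB nN cN SN jc jS).
Qed.

Lemma dot_spread_sum_ge U : bound U <= dot (charv U) (spread_sum N).
Proof.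
rewrite dot_spread_sum; apply: ler_sum => T TB.
by rewrite ler_wpM2l ?dot_spread_ge // ltW ?lam_gt0.
Qed.

Lemma dot_spread_sum_mem S : S \in N -> dot (charv S) (spread_sum N) = bound S.
Proof.
move=> SN; rewrite dot_spread_sum; apply: eq_bigr => T TB.
by rewrite dot_spread_mem.
Qed.

Lemma weighted_spread_sum : weighted (spread_sum N).
Proof.
move=> S SB; split=> [|]; first exact: dot_spread_sum_ge.
rewrite inE => /eqP ->; apply: dot_spread_sum_mem.
by have [] := nN.
Qed.

(** The simplex of the carrier [T] of [U] is spread over the cell of [T], which
    meets [U]; as [T] is not inside [U], this contribution is not counted by the
    bound of [U], and the inequality of [U] is strict. *)
Lemma tight_spread_sum : tight (spread_sum N) = N.
Proof.
apply/setP => U; apply/idP/idP => [/tightP[UB eU]|UN]; last first.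
  by apply/tightP; rewrite dot_spread_sum_mem // (nested_mem nN).
apply: contraT => UN; have [cN Uc _] := carrierP bB nN (building_neq0 bB UB).
set T := carrier N U in cN Uc; have TB := nested_mem nN cN.
have : \sum_(W in B) lam W *
    (dot (charv U) (spread N W) - (W \subset U)%:R) == 0.
  under eq_bigr do rewrite mulrBr.
  by rewrite sumrB -dot_spread_sum eU subrr.
rewrite psumr_eq0 => [/allP/(_ T (mem_index_enum _))|W WB]; last first.
  by rewrite mulr_ge0 ?subr_ge0 ?dot_spread_ge // ltW ?lam_gt0.
have -> : (T \subset U) = false.
  apply/negbTE; apply: contra UN => TU.
  by have -> : U = T by apply/eqP; rewrite finset.eqEsubset Uc.
rewrite TB subr0 mulf_eq0 gt_eqF ?lam_gt0 //= dot_spread -/(J T) mulf_eq0.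
rewrite invr_eq0 [X in _ || X]gt_eqF ?J_gt0 // orbF pnatr_eq0 cards_eq0.
have /set0Pn[j] := meet_cell bB nN UB.
rewrite -/T => /finset.setIP[jU jc] /eqP JU.
have : j \in J T :&: U.
  rewrite finset.in_setI jU andbT finset.in_setI.
  by rewrite (fintype.subsetP Uc) //= (carrier_id bB nN).
by rewrite JU inE.
Qed.

(** Evaluated on the cells, the indicator vectors of the members of [N] form a
    triangular matrix with respect to inclusion. *)
Lemma charv_free (b : {set V} -> R) :
    \sum_(S in N) b S *: charv S = 0 -> forall S, S \in N -> b S = 0.
Proof.
move=> b0 S0 S0N; apply/eqP; apply: contraT => bS0.
pose Q S := (S \in N) && (b S != 0).
have QS0 : Q S0 by rewrite /Q S0N.
case: (arg_maxnP (fun S => #|S|) QS0) => S /andP[SN bS] Smax.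
have /set0Pn[j jS] := cell_neq0 bB nN SN.
have := congr1 (fun v : 'rV_n.+1 => v 0 j) b0; rewrite summxE mxE.
rewrite (bigD1 S) //= !mxE; have -> : j \in S by move: jS; rewrite inE => /andP[].
rewrite mulr1 big1 ?addr0 => [|T /andP[TN TS]]; first by move/eqP: bS.
rewrite !mxE; have [jT|] := boolP (j \in T); last by rewrite mulr0.
have [->|bT] := eqVneq (b T) 0; first by rewrite mul0r.
have ST := cell_sub bB nN SN TN jS jT.
have := Smax T; rewrite /Q TN bT => /(_ isT) /= leTS.
by move: TS; rewrite eq_sym eqEcard ST leTS.
Qed.

Lemma nested_kernel : exists2 U : {vspace 'rV[R]_n.+1},
  (\dim U + #|N| = n.+1)%N &
  forall u, u \in U <-> forall S, S \in N -> dot (charv S) u = 0.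
Proof.
pose A : 'M[R]_(n.+1, #|N|) := \matrix_(j, k) (j \in @enum_val _ (mem N) k)%:R.
pose phi : 'Hom('rV[R]_n.+1, 'rV[R]_#|N|) := linfun (mulmxr A).
have phiE u k : phi u 0 k = dot (charv (@enum_val _ (mem N) k)) u.
  rewrite lfunE /= mxE dotC; apply: eq_bigr => j _.
  by rewrite !mxE.
have Afree : row_free A^T.
  apply: inj_row_free => b bA; apply/rowP => k; rewrite mxE.
  pose b' S := if pick (fun k : 'I_#|N| => @enum_val _ (mem N) k == S) is Some k
               then b 0 k else 0.
  have b'E i : b' (@enum_val _ (mem N) i) = b 0 i.
    rewrite /b'; case: pickP => [l /eqP/enum_val_inj -> //|/(_ i)].
    by rewrite eqxx.
  rewrite -b'E; apply: charv_free (enum_valP k).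
  rewrite big_enum_val -[RHS]bA; apply/rowP => j.
  by rewrite summxE mxE; apply: eq_bigr => i _; rewrite !mxE b'E.
exists (lker phi) => [|u].
  have dimE := limg_ker_dim phi fullv; rewrite capfv dimvf dim_matrix mul1r in dimE.
  suff fullE : limg phi = fullv by rewrite fullE dimvf dim_matrix mul1r in dimE.
  apply/eqP; rewrite eqEsubv subvf; apply/subvP => w _.
  have : row_full A by rewrite /row_full -mxrank_tr.
  move=> /row_fullP[A' A'A]; apply/memv_imgP; exists (w *m A'); first exact: memvf.
  by rewrite lfunE /= -mulmxA A'A mulmx1.
rewrite memv_ker; split=> [/eqP u0 S SN|u0].
  by have := phiE u (enum_rank_in SN S); rewrite u0 mxE enum_rankK_in.
by apply/eqP/rowP => k; rewrite phiE mxE u0 // enum_valP.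
Qed.

End OneFace.
End Weighted.

(** * Affine coordinates on weighted nestohedra *)

Section Realization.
Variables (R : realType) (n : nat).
Local Notation V := 'I_n.+1.
Local Notation top := [set: V]%SET.
Local Notation chi := (@charv R n).
Implicit Types (S T U : {set V}) (N M : {set {set V}}).

Variables (B : {set {set V}}) (lam : {set V} -> R).
Hypothesis cB : connected_building_set B.
Hypothesis lam_gt0 : forall S, S \in B -> 0 < lam S.

Variables (d : nat) (p : 'rV[R]_n.+1) (Psi : 'M[R]_(d, n.+1)).

Definition pulled S : 'rV[R]_d := chi S *m Psi^T.
Definition pulled_bound S : R := bound B lam S - dot (chi S) p.
(** The polytope [weighted B lam] read in the affine coordinates
    [y |-> p + y *m Psi]. *)
Definition realization : set 'rV[R]_d :=
  solutions pulled pulled_bound B [set top]%SET.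

Local Notation ptight := (tight pulled pulled_bound B).
Local Notation ptight_face := (tight_face pulled pulled_bound B [set top]%SET).

Lemma dot_pulled S y : dot (pulled S) y = dot (chi S) (y *m Psi).
Proof. by rewrite /pulled -dot_mulmx. Qed.

Lemma realizationP y : realization y <-> weighted B lam (p + y *m Psi).
Proof.
by split=> Py S SB; have [le eq] := Py S SB; move: le eq;
  rewrite linearD /= -dot_pulled /pulled_bound;
  (split; [lra|move=> /eq; lra]).
Qed.

Lemma tight_realization y : ptight y = tight chi (bound B lam) B (p + y *m Psi).
Proof.
apply/setP => S; rewrite !inE linearD /= -dot_pulled /pulled_bound.
by rewrite -subr_eq0 -[in RHS]subr_eq0; congr (_ && (_ == _)); ring.
Qed.

Hypothesis Psi_inj : forall u : 'rV[R]_d, u *m Psi = 0 -> u = 0.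
Hypothesis Psi_onto : forall x, dot (chi top) x = bound B lam top ->
  exists y, x = p + y *m Psi.

Let tB : top \in B. Proof. by have [] := cB. Qed.
Let bB : building_set B. Proof. by have [] := cB. Qed.

Lemma weighted_top x : weighted B lam x -> dot (chi top) x = bound B lam top.
Proof. by move=> Px; have [_ -> //] := Px _ tB; rewrite inE. Qed.

Lemma realization_nested y : realization y -> nested B (ptight y).
Proof.
move=> /realizationP Py; rewrite tight_realization.
exact: (weighted_nested cB lam_gt0).
Qed.

Lemma realization_attained N : nested B N ->
  exists2 y, realization y & ptight y = N.
Proof.
move=> nN; have Px := weighted_spread_sum cB lam_gt0 nN.
have [y yE] := Psi_onto (weighted_top Px).
exists y; first by apply/realizationP; rewrite -yE.
by rewrite tight_realization -yE (tight_spread_sum cB lam_gt0 nN).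
Qed.

Lemma realization_complex : has_face_complex realization (nested B).
Proof. exact: system_face_complex realization_nested realization_attained. Qed.

Lemma kernel_in_image v : dot (chi top) v = 0 -> exists y, v = y *m Psi.
Proof.
move=> v0; have [y0 Py _] := realization_attained (nested_top tB).
have [y1 E] : exists y, p + y0 *m Psi + v = p + y *m Psi.
  apply: Psi_onto; rewrite linearD /= v0 addr0.
  by apply/weighted_top/realizationP.
exists (y1 - y0); rewrite mulmxBl; apply: (addrI (p + y0 *m Psi)); rewrite E.
by rewrite -addrA subrKC.
Qed.

Lemma realization_face_dim N : nested B N ->
  exists2 k, has_dim (ptight_face N) k & (k + #|N| = n.+1)%N.
Proof.
move=> nN; have [y Py yN] := realization_attained nN.
have [U dimU memU] := nested_kernel R cB nN.
pose psi : 'Hom('rV[R]_d, 'rV[R]_n.+1) := linfun (mulmxr Psi).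
have psiE u : psi u = u *m Psi by rewrite lfunE.
have imU : (psi @: (psi @^-1: U))%VS = U.
  apply: lpreimK; apply/subvP => v /memU vN.
  have [|w ->] := @kernel_in_image v; first by apply: vN; have [] := nN.
  by rewrite -psiE memv_img ?memvf.
have dimE : \dim (psi @^-1: U) = \dim U.
  rewrite -[in RHS]imU limg_dim_eq //; apply/eqP; rewrite -subv0.
  apply/subvP => u; rewrite memv_cap memv_ker psiE => /andP[_ /eqP/Psi_inj ->].
  exact: mem0v.
exists (\dim U) => //; rewrite -dimE -yN; apply: has_dim_tight_face => // u.
rewrite -memv_preim psiE memU -yN.
by split=> uN S /uN; rewrite dot_pulled.
Qed.

Lemma nested_top_in N : nested B N -> top \in N.
Proof. by case. Qed.

Lemma realization_dim : has_dim realization n.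
Proof.
apply: (system_dim (K := nested B) realization_nested (nested_top tB)).
- exact: nested_top_in.
- exact: realization_face_dim.
Qed.

Lemma realization_facet S : S \in B -> S != top ->
  facet realization (ptight_face [set top; S]%SET).
Proof.
move=> SB St; apply: (facet_tight_face (K := nested B) realization_nested
  realization_attained (nested_top tB) nested_top_in realization_face_dim) => //.
exact: nested1.
Qed.

Lemma realization_simple : is_simple realization.
Proof.
apply: (system_simple (K := nested B) realization_nested realization_attained
  (nested_top tB) nested_top_in _ realization_face_dim).
by move=> N M; apply: nested_sub.
Qed.

Lemma realization_vertex v : vertex realization v ->
  rigid pulled pulled_bound B [set top]%SET v.
Proof. exact: vertex_rigid. Qed.

Lemma realization_hull :
  realization = convex_hull (rigid pulled pulled_bound B [set top]%SET).
Proof.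
have [_ B1 _] := bB.
apply: solutions_hull => u u_ge0 u_top; apply: Psi_inj.
have u0 j : 0 <= (u *m Psi) 0 j.
  by have := u_ge0 _ (B1 j); rewrite dot_pulled dot_charv big_set1.
have : \sum_(j in top) (u *m Psi) 0 j == 0.
  by rewrite -dot_charv -dot_pulled u_top // inE.
rewrite psumr_eq0 // => /allP u00; apply/rowP => j.
have /implyP := u00 j (mem_index_enum _).
by rewrite inE [RHS]mxE => /(_ isT)/eqP.
Qed.

Lemma realization_polytope : polytope realization.
Proof.
exists (rigid pulled pulled_bound B [set top]%SET); first exact: finite_rigid.
exact: realization_hull.
Qed.

End Realization.

Lemma dot_continuous (R : realType) d (a : 'rV[R]_d) : continuous (dot a).
Proof.
rewrite /dot; apply: continuous_big => [|j _]; first exact: add_continuous.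
move=> x; apply: cvgMl_tmp; first exact: (nbhs_filter x).
exact: (@coord_continuous _ _ _ 0 j x).
Qed.

Lemma strict_interior (R : realType) d (T : finType) (a : T -> 'rV[R]_d)
    (c : T -> R) (D E : {set T}) :
    (forall i, i \in D -> c i < 0 \/ ((forall y, dot (a i) y = 0) /\ c i = 0)) ->
    (forall i, i \in D -> i \in E -> (forall y, dot (a i) y = 0) /\ c i = 0) ->
  (solutions a c D E)° 0.
Proof.
move=> lt0 eq0.
have : \forall y \near (0 : 'rV[R]_d), forall i, i \in D -> c i <= dot (a i) y.
  apply: (@filter_forall _ _ (fun i (y : 'rV[R]_d) => i \in D -> c i <= dot (a i) y)
    _ (nbhs_filter (0 : 'rV[R]_d))) => i.
  have [iD|iD] := boolP (i \in D); last exact: nearW.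
  have [ci|[ai ci]] := lt0 i iD; last first.
    by apply: nearW => y _; rewrite ai ci.
  have /cvgr_gt/(_ (c i)) := @dot_continuous R d (a i) 0.
  by rewrite linear0 => /(_ ci); apply: filterS => y /ltW.
apply: filterS => y cy i iD; split; first exact: cy.
by move=> iE; have [-> ->] := eq0 i iD iE.
Qed.

(** * One shaving *)

Section ZeroSum.
Variables (R : realType) (n : nat).
Local Notation top := [set: 'I_n.+1]%SET.

(** The rows form a basis of the hyperplane of vectors of zero sum, in which
    nestohedra become full-dimensional. *)
Definition zero_sum : 'M[R]_(n, n.+1) :=
  \matrix_(i, j) ((j == lift ord0 i)%:R - (j == ord0)%:R).

Lemma zero_sum_lift (y : 'rV[R]_n) i : (y *m zero_sum) 0 (lift ord0 i) = y 0 i.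
Proof.
rewrite mxE (bigD1 i) //= !mxE eqxx subr0 mulr1 big1 ?addr0 // => j ji.
by rewrite mxE (inj_eq lift_inj) eq_sym (negPf ji) subr0 mulr0.
Qed.

Lemma zero_sum0 (y : 'rV[R]_n) : (y *m zero_sum) 0 ord0 = - \sum_i y 0 i.
Proof.
rewrite mxE -sumrN; apply: eq_bigr => i _.
by rewrite mxE eqxx sub0r mulrN1.
Qed.

Lemma dot_top_zero_sum y : dot (charv R top) (y *m zero_sum) = 0.
Proof.
rewrite dot_charv (eq_bigl xpredT) => [|j]; last by rewrite inE.
rewrite big_ord_recl zero_sum0; under [X in _ + X]eq_bigr do rewrite zero_sum_lift.
by rewrite addNr.
Qed.

Lemma zero_sum_inj (y : 'rV[R]_n) : y *m zero_sum = 0 -> y = 0.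
Proof. by move=> y0; apply/rowP => i; rewrite -zero_sum_lift y0 !mxE. Qed.

Lemma zero_sum_onto v : dot (charv R top) v = 0 -> exists y, v = y *m zero_sum.
Proof.
rewrite dot_charv (eq_bigl xpredT) => [|j]; last by rewrite inE.
rewrite big_ord_recl => /eqP; rewrite addr_eq0 => /eqP v0.
exists (\row_i v 0 (lift ord0 i)); apply/rowP => j.
have [i ->|->] := unliftP ord0 j; first by rewrite zero_sum_lift mxE.
by rewrite zero_sum0 v0; congr (- _); apply: eq_bigr => i _; rewrite mxE.
Qed.

End ZeroSum.

Section Moebius.
Variables (R : realType) (n : nat) (B : {set {set 'I_n.+1}}).
Hypothesis bB : building_set B.
Implicit Types S T : {set 'I_n.+1}.

(** Right-hand sides that do not depend on the building set: adjoining a set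
    then leaves the other inequalities unchanged. *)
Definition growth S : R := #|{set 'I_n.+1}|.+1%:R ^+ #|S|.

(** Solving for the weights by induction on the size of [S] keeps them positive
    because [growth S] exceeds the sum of [growth] over all smaller sets. *)
Lemma growth_weights : exists lam : {set 'I_n.+1} -> R,
  (forall S, S \in B -> 0 < lam S) /\ forall S, S \in B -> bound B lam S = growth S.
Proof.
set m := #|{set 'I_n.+1}|.
have m1 : 1 <= m.+1%:R :> R by rewrite ler1n.
suff H k : exists lam : {set 'I_n.+1} -> R, forall S, S \in B -> (#|S| < k)%N ->
    0 < lam S <= growth S /\ bound B lam S = growth S.
  have [lam lamP] := H n.+2; exists lam.
  have small S : (#|S| < n.+2)%N by rewrite ltnS (leq_trans (max_card _)) ?card_ord.
  by split=> S SB; have [/andP[? ?] ?] := lamP S SB (small S).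
elim: k => [|k [lam lamP]]; first by exists (fun=> 0).
pose rest S := \sum_(T in B | T != S) lam T * (T \subset S)%:R.
pose lam' S := if (#|S| < k)%N then lam S else growth S - rest S.
have boundE S : S \in B -> (#|S| < k.+1)%N -> bound B lam' S = lam' S + rest S.
  move=> SB Sk; rewrite /bound (bigD1 S) //= fintype.subxx mulr1; congr (_ + _).
  apply: eq_bigr => T /andP[TB TS]; have [TS'|] := boolP (T \subset S); last first.
    by rewrite !mulr0.
  rewrite /lam' ifT //; rewrite ltnS in Sk; apply: leq_trans Sk.
  by rewrite proper_card // finset.properEneq TS.
exists lam' => S SB Sk; rewrite boundE //.
have [Sk'|Sk'] := ltnP #|S| k.
  have [b0 bE] := lamP S SB Sk'; rewrite /lam' Sk'; split=> //.
  by rewrite -bE /bound (bigD1 S) //= fintype.subxx mulr1.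
have kS : #|S| = k by apply/eqP; rewrite eqn_leq Sk' -ltnS Sk.
rewrite /lam' ltnNge Sk' /= subrK; split=> //.
have small T : T \in B -> T != S -> T \subset S -> (#|T| < k)%N.
  by move=> TB TS TsS; rewrite -kS proper_card // finset.properEneq TS.
have rest0 : 0 <= rest S.
  apply: sumr_ge0 => T /andP[TB TS]; have [TsS|] := boolP (T \subset S).
    by have [/andP[/ltW ? _] _] := lamP T TB (small T TB TS TsS); rewrite mulr1.
  by rewrite mulr0.
rewrite gerBl rest0 andbT subr_gt0.
have k0 : (0 < k)%N by rewrite -kS card_gt0 (building_neq0 bB).
have le T : T \in B -> T != S -> lam T * (T \subset S)%:R <= m.+1%:R ^+ k.-1.
  move=> TB TS; have [TsS|] := boolP (T \subset S); last first.
    by rewrite mulr0 exprn_ge0 // ler0n.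
  have Tk := small T TB TS TsS.
  have [/andP[_ lamT] _] := lamP T TB Tk; rewrite mulr1 (le_trans lamT) //.
  by rewrite /growth ler_weXn2l //; move: Tk; lia.
have : rest S <= \sum_(T in B | T != S) m.+1%:R ^+ k.-1.
  by apply: ler_sum => T /andP[]; apply: le.
rewrite sumr_const => /le_lt_trans; apply.
rewrite /growth kS -/m -[in X in _ < X](prednK k0) exprS.
rewrite -[X in X < _]mulr_natl.
by rewrite ltr_pM2r ?exprn_gt0 ?ltr0n // ltr_nat ltnS max_card.
Qed.

End Moebius.

Section ShavingStep.
Variables (R : realType) (n : nat) (B : {set {set 'I_n.+1}}).
Local Notation top := [set: 'I_n.+1]%SET.
Variables S T : {set 'I_n.+1}.
Hypotheses (cB : connected_building_set B) (SB : S \in B) (TB : T \in B).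
Hypotheses (ST0 : S :&: T = finset.set0) (STB : S :|: T \notin B).
Local Notation W := (S :|: T).
Local Notation B' := (W |: B).
Hypothesis bB' : building_set B'.

(** The origin is placed at a point [p] strictly inside the polytope of the larger
    building set, hence inside both.  A vertex whose tight sets stay nested
    after the adjunction is the point of the larger polytope with these tight
    sets, so it satisfies the new inequality strictly. *)
Lemma shaving_step : exists P G Q : set 'rV[R]_n,
  [/\ has_face_complex P (nested B), face_codim P G 2, shaving P G Q
    & has_face_complex Q (nested B')].
Proof.
have [bB tB] := cB; have tB' : top \in B' by rewrite inE tB orbT.
have cB' : connected_building_set B' by [].
have BB' U : U \in B -> U \in B' by move=> UB; rewrite inE UB orbT.
have [lam [lam0 lamE]] := growth_weights R bB.
have [lam' [lam'0 lam'E]] := growth_weights R bB'.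
have [tN tS tT] : [/\ S :|: T != top, S != top & T != top].
  split; apply: contraNneq STB => ->; rewrite ?finset.setTU ?finset.setUT //.
pose p := spread_sum B' lam' [set top]%SET.
have nt := nested_top tB'.
have Pp : weighted B' lam' p := weighted_spread_sum cB' lam'0 nt.
have tp : tight (@charv R n) (bound B' lam') B' p = [set top]%SET.
  by rewrite /p (tight_spread_sum cB' lam'0 nt).
have WB' : W \in B' by rewrite !inE eqxx.
have p_gt U : U \in B' -> U != top -> growth R U < dot (charv R U) p.
  move=> UB Ut; have [le _] := Pp U UB; rewrite -lam'E // lt_neqAle le andbT.
  apply: contra Ut => /eqP eU; have : U \in [set top]%SET by rewrite -tp; apply/tightP.
  by rewrite inE.
have p_top : dot (charv R top) p = growth R top.
  by have [_ ->] := Pp top tB'; rewrite ?lam'E // inE.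
have onto (C : {set {set 'I_n.+1}}) mu : top \in C ->
    (forall U, U \in C -> bound C mu U = growth R U) ->
    forall x, dot (charv R top) x = bound C mu top ->
    exists y : 'rV_n, x = p + y *m zero_sum R n.
  move=> tC CE x; rewrite CE // -p_top => xp.
  have [|y yE] := @zero_sum_onto R n (x - p); first by rewrite linearB /= xp subrr.
  by exists y; rewrite -yE subrKC.
have ontoB := onto B lam tB lamE; have ontoB' := onto B' lam' tB' lam'E.
have inj := @zero_sum_inj R n.
pose P := realization B lam p (zero_sum R n).
pose Q := realization B' lam' p (zero_sum R n).
pose X (y : 'rV[R]_n) := p + y *m zero_sum R n.
have PP y : P y -> forall U, U \in B -> growth R U <= dot (charv R U) (X y).
  by move=> /realizationP Py U UB; have [] := Py U UB; rewrite lamE.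
have dotW y : dot (charv R W) y = dot (charv R S) y + dot (charv R T) y.
  by rewrite -dot_charvUI ST0 [X in _ + X]dot_charv big_set0 addr0.
pose N := top |: [set S; T]%SET.
have nN : nested B N by apply: nested2.
pose G := tight_face (pulled (zero_sum R n)) (pulled_bound B lam p) B [set top]%SET N.
have tightE y : P y -> forall U, U \in B ->
    (U \in tight (pulled (zero_sum R n)) (pulled_bound B lam p) B y) =
    (dot (charv R U) (X y) == growth R U).
  by move=> Py U UB; rewrite tight_realization inE UB lamE.
have GP y : G y <-> P y /\ dot (charv R W) (X y) = growth R S + growth R T.
  rewrite dotW; split=> [[Py NY]|[Py yW]]; split=> //.
    move: NY; rewrite !finset.subUset !finset.sub1set !tightE //.
    by move=> /and3P[_ /eqP -> /eqP ->].
  have := PP y Py S SB; have := PP y Py T TB => leT leS.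
  rewrite !finset.subUset !finset.sub1set !tightE // !eq_le leS leT !andbT.
  rewrite (_ : _ <= growth R S); last by lra.
  rewrite (_ : _ <= growth R T); last by lra.
  by rewrite /X linearD /= dot_top_zero_sum addr0 p_top lexx.
(* Seen from [p], the inequality that supports the face [G] has slack [al];
   dividing by it makes the maximum of [l] equal to 1. *)
pose al := dot (charv R W) p - growth R S - growth R T.
have al0 : 0 < al.
  have := p_gt S (BB' S SB) tS; have := p_gt T (BB' T TB) tT.
  by rewrite /al dotW; lra.
pose l := dot (- al^-1 *: pulled (zero_sum R n) W).
have lE y : l y = (dot (charv R W) p - dot (charv R W) (X y)) / al.
  rewrite /l dotC linearZ /= dotC dot_pulled /X linearD /=.
  by field; rewrite gt_eqF.
pose eps := 1 - (dot (charv R W) p - growth R W) / al.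
have epsE : 1 - eps = (dot (charv R W) p - growth R W) / al by rewrite /eps subKr.
have QP y : Q y <-> P y /\ growth R W <= dot (charv R W) (X y).
  split=> [/realizationP Qy|[/realizationP Py Wy]].
    split; last by rewrite -lam'E //; have [] := Qy W WB'.
    apply/realizationP => U UB; rewrite (lamE _ UB) -(lam'E _ (BB' U UB)).
    exact (Qy U (BB' U UB)).
  apply/realizationP => U UB'; rewrite (lam'E _ UB').
  move: (UB'); rewrite !inE => /predU1P[->|UB]; last first.
    by have := Py U UB; rewrite (lamE _ UB) inE.
  by split=> //; rewrite (negPf tN).
have growth_ST : growth R S + growth R T < growth R W.
  rewrite /growth cardsU ST0 cards0 subn0 exprD.
  (* The base of [growth] is at least 3 because there are at least two sets. *)
  set M := #|_|.+1%:R.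
  have M3 : 3 <= M :> R.
    rewrite ler_nat ltnS; have := max_card (mem [set finset.set0; top]%SET).
    by rewrite cards2 eq_sym (building_neq0 bB tB).
  have pow U : U \in B -> 3 <= M ^+ #|U|.
    move=> /(building_neq0 bB); rewrite -card_gt0 => U0.
    apply: le_trans M3 _; rewrite -[X in X <= _]expr1 ler_weXn2l //.
    by rewrite ler1n.
  have := pow S SB; have := pow T TB; nra.
have P0 : P 0.
  apply/realizationP; rewrite mul0mx addr0 => U UB; rewrite lamE //.
  by have := Pp U (BB' U UB); rewrite (lam'E _ (BB' U UB)).
have [k dk kN] := realization_face_dim cB lam0 inj ontoB nN.
have cardN : #|N| = 3.
  have SnT : S != T.
    by apply: contraNneq (building_neq0 bB SB) => E; rewrite -ST0 -E finset.setIid.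
  by rewrite cardsU1 !inE negb_or ![top == _]eq_sym tS tT cards2 SnT.
have faceG : face P G.
  by apply: tight_face_face; have [] := nN.
have dimP : has_dim P n := realization_dim cB lam0 inj ontoB.
exists P, G, Q; split.
- exact (realization_complex cB lam0 ontoB).
- split=> //; exists k; split=> //.
  suff -> : (k + 2 = n)%N by [].
  by move: kN; rewrite cardN addn3 addn2 => -[].
- split; last split.
  + split=> //.
    * exact: realization_polytope.
    * exact: realization_simple.
    have top0 : (forall y, dot (pulled (zero_sum R n) top) y = 0) /\
        pulled_bound B lam p top = 0.
      split=> [y|]; first by rewrite dot_pulled dot_top_zero_sum.
      by rewrite /pulled_bound lamE // p_top subrr.
    apply: strict_interior => U UB; last by rewrite inE => /eqP ->.
    have [->|Ut] := eqVneq U top; first by right.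
    by left; rewrite /pulled_bound lamE // subr_lt0 p_gt // BB'.
  + split=> //.
      have [y Py yN] := realization_attained cB lam0 ontoB nN.
      by exists y; split; rewrite ?yN.
    move=> E; have : G 0 by rewrite E.
    move=> /GP[_]; rewrite /X mul0mx addr0 => E'.
    by move: al0; rewrite /al; lra.
  + exists l, eps; split.
    * move=> y Py; rewrite -[X in X <= _]/(l y) lE ler_pdivrMr // mul1r /al dotW.
      by have := PP y Py S SB; have := PP y Py T TB; rewrite dotW; lra.
    * apply/seteqP; split=> y; rewrite /= -[X in X = 1]/(l y) lE.
        move=> /GP[Py ->]; split=> //.
        by rewrite opprD addrA divff // gt_eqF.
      move=> [Py /(canRL (divfK _))]; rewrite gt_eqF // => /(_ isT) E.
      by apply/GP; split=> //; move: E; rewrite /al; lra.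
    * by rewrite subr_gt0 ltr_pdivrMr // mul1r /al; have := growth_ST; lra.
    * move=> v fv nGv; rewrite -[X in X < _]/(l v) lE epsE.
      rewrite ltr_pM2r ?invr_gt0 // ltrD2l ltrN2.
      have rv := realization_vertex fv; have Pv : P v := rv.1.
      have nv := realization_nested cB lam0 Pv.
      set N0 := tight _ _ _ v in nv.
      have nv' : nested B' N0.
        apply: nested_adjoin => //; apply/negP => STv; apply: nGv; split=> //.
        by rewrite finset.subUset STv finset.sub1set (nested_top_in nv).
      have [y Qy yN0] := realization_attained cB' lam'0 ontoB' nv'.
      have QP' z : Q z -> P z by move=> /QP[].
      have yv : y = v.
        apply: (rigid_eq rv) (QP' _ Qy) _; rewrite -/N0 -yN0.
        apply/fintype.subsetP => U Uy; have UB : U \in B.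
          by rewrite yN0 in Uy; apply: (nested_mem nv).
        rewrite tightE //; last exact: QP'.
        move: Uy; rewrite tight_realization inE => /andP[UB' /eqP ->].
        by rewrite lam'E.
      have [_ leW] : P v /\ growth R W <= dot (charv R W) (X v).
        by apply/QP; rewrite -yv.
      rewrite lt_neqAle leW andbT; apply: contra STB => /eqP eW.
      apply: (nested_mem nv); rewrite -yN0 yv tight_realization.
      by apply/tightP; rewrite lam'E.
    * apply/seteqP; split=> y; rewrite /= -[X in X <= 1 - _]/(l y) lE epsE;
        rewrite ler_pM2r ?invr_gt0 // lerD2l lerN2; exact: (QP y).1 + exact: (QP y).2.
- exact (realization_complex cB' lam'0 ontoB').
Qed.
End ShavingStep.

(** * Shavings between building sets *)

(** Each adjunction brings the building set closer to [C], and only the face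
    poset matters from one step to the next. *)
Lemma shavings_between (R : realType) n (B C : {set {set 'I_n.+1}})
    d (P : set 'rV[R]_d) e (Q : set 'rV[R]_e) :
    connected_building_set B -> building_set C -> B \subset C ->
    (forall S, S \in C -> (1 < #|S|)%N -> splits C S) ->
    has_face_complex P (nested B) -> has_face_complex Q (nested C) ->
  obtained_by_codim2_shavings Q P.
Proof.
move=> + bC + Csplits + cQ; have [k] := ubnP #|C :\: B|.
elim: k B d P => // k IH B d P; rewrite ltnS => Ck cB BC cP.
have [BE|BnC] := eqVneq B C.
  rewrite -BE in cQ; apply: codim2_shavings_none.
  exact: comb_equiv_face_complex cP cQ.
have BpC : B \proper C by rewrite finset.properEneq BnC.
have [S [T [SB TB ST STn bB']]] := exists_adjunction cB bC BpC Csplits.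
have [STB STC] : S :|: T \notin B /\ S :|: T \in C.
  by move: STn; rewrite inE => /andP[].
have [P' [G [Q' [cP' dimG shP cQ']]]] := shaving_step R cB SB TB ST STB bB'.
apply: (codim2_shavings_step _ dimG shP); first exact: comb_equiv_face_complex cP cP'.
have [_ tB] := cB.
apply: (IH (S :|: T |: B)) => //.
- apply: leq_trans Ck; apply: proper_card; apply/properP; split.
    by apply: finset.setDS; apply: finset.subsetUr.
  by exists (S :|: T); rewrite // !inE eqxx.
- by split; rewrite // inE tB orbT.
- by rewrite finset.subUset finset.sub1set STC.
Qed.

(** * Nestohedra *)

Section Nestohedron.
Variables (R : realType) (n : nat) (B : {set {set 'I_n.+1}}).
Local Notation top := [set: 'I_n.+1]%SET.
Hypothesis cB : connected_building_set B.
Implicit Types (S T U : {set 'I_n.+1}) (x : 'rV[R]_n.+1).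

Let one S : R := 1.
Let one_gt0 S : S \in B -> 0 < one S. Proof. by []. Qed.

Local Notation H := (realization B one 0 (1%:M : 'M[R]_n.+1)).

Let H_weighted x : H x <-> weighted B one x.
Proof.
rewrite -[X in weighted _ _ X]add0r -[in X in weighted _ _ X](mulmx1 x).
exact: realizationP.
Qed.

Let id_inj (u : 'rV[R]_n.+1) : u *m 1%:M = 0 -> u = 0.
Proof. by rewrite mulmx1. Qed.

Let id_onto x : dot (charv R top) x = bound B one top ->
  exists y : 'rV[R]_n.+1, x = 0 + y *m 1%:M.
Proof. by move=> _; exists x; rewrite mulmx1 add0r. Qed.

Lemma simplex_dot S x : simplex S x ->
  dot (charv R top) x = 1 /\ forall U, (S \subset U)%:R <= dot (charv R U) x.
Proof.
pose C : set 'rV[R]_n.+1 := [set z | dot (charv R top) z = 1 /\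
  forall U, (S \subset U)%:R <= dot (charv R U) z].
suff : simplex S `<=` C by apply.
apply: convex_hull_sub.
  apply/convex_setP => y z t [y1 yU] [z1 zU] /andP[t0 t1].
  split=> [|U]; rewrite linearD !linearZ /=; first by rewrite y1 z1; ring.
  have t1' : 0 <= 1 - t by rewrite subr_ge0.
  have := ler_wpM2l t0 (yU U); have := ler_wpM2l t1' (zU U); lra.
move=> _ [j jS <-]; split=> [|U]; rewrite dot_charv_delta ?inE //.
have [/fintype.subsetP SU|] := boolP (S \subset U); last by rewrite ler0n.
by rewrite SU.
Qed.

Lemma spread_simplex N S : nested B N -> S \in B -> simplex S (spread R N S).
Proof.
move=> nN SB; apply: convex_mean.
- exact: convex_hull_convex.
- exact (meet_cell cB.1 nN SB).
- by move=> j /finset.setIP[jS _]; apply: sub_convex_hull; exists j.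
Qed.

Lemma nestohedron_convex : convex_set (nestohedron R B).
Proof.
apply/convex_setP => _ _ t [y yS <-] [z zS <-] t01.
exists (fun S => t *: y S + (1 - t) *: z S).
  move=> S SB; apply: (convex_setP _).1 => //; [|exact: yS|exact: zS].
  exact: convex_hull_convex.
by rewrite big_split -!scaler_sumr.
Qed.

(** A vertex is determined by its tight inequalities, hence equals the sum of
    the points that [spread] selects in the simplices. *)
Lemma nestohedronE : nestohedron R B = H.
Proof.
apply/seteqP; split=> [_ [y yS <-]|].
  apply/H_weighted => U UB; rewrite linear_sum /= /bound; split.
    apply: ler_sum => S SB; rewrite mul1r.
    by have [_] := simplex_dot (yS S SB).
  rewrite inE => /eqP ->; apply: eq_bigr => S SB.
  by have [-> _] := simplex_dot (yS S SB); rewrite finset.subsetT mulr1.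
rewrite (realization_hull one cB 0 id_inj).
apply: convex_hull_sub; first exact: nestohedron_convex.
move=> v rv; have nv := realization_nested cB one_gt0 rv.1.
set N := tight _ _ _ v in nv.
have Hx := weighted_spread_sum cB one_gt0 nv.
have <- : spread_sum B one N = v.
  apply: (rigid_eq rv); first by apply/H_weighted.
  rewrite -/N tight_realization add0r mulmx1.
  by rewrite (tight_spread_sum cB one_gt0 nv).
exists (spread R N) => [S SB|]; first exact: spread_simplex.
by apply: eq_bigr => S _; rewrite scale1r.
Qed.

Lemma nestohedron_complex : has_face_complex (nestohedron R B) (nested B).
Proof. by rewrite nestohedronE; exact (realization_complex cB one_gt0 id_onto). Qed.

(** If [S] does not split, consider the facets of the disjoint members given by
    [splits_or_cover].  They meet pairwise, as each pair of these members is
    nested; a common point of all of them would make the whole family nested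
    although its union [S] is in [B]. *)
Lemma flag_splits : is_flag (nestohedron R B) ->
  forall S, S \in B -> (1 < #|S|)%N -> splits B S.
Proof.
rewrite nestohedronE => flag S SB S1; have [bB tB] := cB.
apply: contrapT => /(splits_or_cover cB SB S1)[M [MB M0 cM SM Mpair]].
have {}MB X : X \in M -> X \in B by apply: (fintype.subsetP MB).
pose F X := tight_face (pulled (1%:M : 'M[R]_n.+1)) (pulled_bound B one 0) B
  [set top]%SET [set top; X]%SET.
have meet N X Y : nested B N -> [set top; X]%SET \subset N ->
    [set top; Y]%SET \subset N -> F X `&` F Y !=set0.
  move=> nN XN YN; have [y Hy yN] := realization_attained cB one_gt0 id_onto nN.
  by exists y; split; split=> //; rewrite yN.
have [||x Fx] := flag (F @` [set X | X \in M]).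
- move=> _ [X /= XM <-].
  apply: (realization_facet cB one_gt0 id_inj id_onto (MB X XM)).
  apply: contraNneq SM => Xt; suff -> : S = X by [].
  by apply/eqP; rewrite Xt -finset.subTset -Xt -cM cover_sup.
- move=> _ _ [X /= XM <-] [Y /= YM <-].
  have [->|XY] := eqVneq X Y.
    by apply: (meet [set top; Y]%SET) => //; apply: nested1 => //; exact: MB.
  have [_ XYB] := Mpair X Y XM YM XY.
  apply: (meet (top |: [set X; Y]%SET)); first by apply: nested2 => //; exact: MB.
    by rewrite finset.subUset !finset.sub1set !inE !eqxx !orbT.
  by rewrite finset.subUset !finset.sub1set !inE !eqxx !orbT.
have FMx X : X \in M -> F X x by move=> XM; apply: Fx; exists X.
have /set0Pn[X0 /FMx[Hx _]] := M0.
have [_ _ cN] := realization_nested cB one_gt0 Hx.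
case/negP: SM; rewrite -cM; apply: cN => //; last by rewrite cM.
apply/fintype.subsetP => X /FMx[_]; rewrite finset.subUset !finset.sub1set.
by case/andP.
Qed.

End Nestohedron.

(** * The cube *)

Section SplittingTree.
Variable n : nat.
Implicit Types (B : {set {set 'I_n.+1}}) (S T X Y : {set 'I_n.+1}).
Implicit Type s : seq ({set 'I_n.+1} * {set 'I_n.+1}).

Definition nodes S s : seq {set 'I_n.+1} := S :: unzip1 s ++ unzip2 s.
Arguments nodes : simpl never.

(** A full binary tree rooted at [S] whose leaves are the singletons.  It is given
    by the list of its pairs of siblings, one pair for each inner node: for the
    ground set the pairs correspond to the directions of the cube. *)
Record splitting_tree B S s : Prop := SplittingTree {
  tree_size : (size s).+1 = #|S|;
  tree_uniq : uniq (nodes S s);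
  tree_mem : forall X, X \in nodes S s -> X \in B;
  tree_sub : forall X, X \in nodes S s -> X \subset S;
  tree_pair : forall X Y, (X, Y) \in s ->
    X :&: Y = finset.set0 /\ X :|: Y \in nodes S s;
  tree_laminar : forall X Y, X \in nodes S s -> Y \in nodes S s ->
    [\/ X :&: Y = finset.set0, X \subset Y | Y \subset X];
  tree_leaf : forall i, i \in S -> [set i]%SET \in nodes S s;
  tree_split : forall X, X \in nodes S s -> (1 < #|X|)%N ->
    exists Y Z, (Y, Z) \in s /\ X = Y :|: Z
}.

Lemma exists_splitting_tree B S : building_set B ->
    (forall T, T \in B -> (1 < #|T|)%N -> splits B T) -> S \in B ->
  exists s, splitting_tree B S s.
Proof.
move=> bB Bsplits; have [k] := ubnP #|S|; elim: k S => // k IH S.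
rewrite ltnS => Sk SB; have [S1|S1] := ltnP 1 #|S|; last first.
  have S1' : #|S| = 1 by apply/eqP; rewrite eqn_leq S1 card_gt0 (building_neq0 bB).
  exists [::]; split=> //=.
  - by move=> X; rewrite inE => /eqP ->.
  - by move=> X; rewrite inE => /eqP ->; exact: fintype.subxx.
  - by move=> X Y; rewrite !inE => /eqP -> /eqP ->; constructor 2; exact: fintype.subxx.
  - move=> i iS; have /cards1P[j Sj] : #|S| == 1 by rewrite S1'.
    by move: iS; rewrite Sj !inE => /eqP ->.
  - by move=> X; rewrite inE => /eqP ->; rewrite S1'.
have [S' [S'' [S'B S''B SS' SE]]] := Bsplits S SB S1.
have [lt' lt''] := splits_ltn bB S'B S''B SS' SE.
have [s' t'] := IH S' (leq_trans lt' Sk) S'B.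
have [s'' t''] := IH S'' (leq_trans lt'' Sk) S''B.
pose s := (S', S'') :: s' ++ s''.
have sE : perm_eq (nodes S s) (S :: nodes S' s' ++ nodes S'' s'').
  apply/permP => a; rewrite /nodes /s /unzip1 /unzip2 /= !map_cat.
  by rewrite ?count_cat /= ?count_cat /= ?count_cat /= ?count_cat; lia.
have memE X : (X \in nodes S s) = [|| X == S, X \in nodes S' s' | X \in nodes S'' s''].
  by rewrite (perm_mem sE) inE mem_cat.
have sub' X : X \in nodes S' s' -> X \subset S' by move=> /(tree_sub t').
have sub'' X : X \in nodes S'' s'' -> X \subset S'' by move=> /(tree_sub t'').
have S'S : S' \subset S by rewrite -SE finset.subsetUl.
have S''S : S'' \subset S by rewrite -SE finset.subsetUr.
have cross X Y : X \in nodes S' s' -> Y \in nodes S'' s'' -> X :&: Y = finset.set0.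
  move=> /sub' XS' /sub'' YS''; apply/eqP; rewrite -finset.subset0 -SS'.
  exact: finset.setISS.
have subS X : X \in nodes S s -> X \subset S.
  rewrite memE => /or3P[/eqP ->|/sub' XS'|/sub'' XS'']; first exact: fintype.subxx.
    exact: fintype.subset_trans XS' S'S.
  exact: fintype.subset_trans XS'' S''S.
exists s; split=> //.
- rewrite /= size_cat -SE cardsU SS' cards0 subn0.
  by rewrite -(tree_size t') -(tree_size t''); lia.
- rewrite (perm_uniq sE) cons_uniq cat_uniq (tree_uniq t') (tree_uniq t'').
  rewrite mem_cat negb_or !andbT andTb -andbA; apply/and3P; split.
  + by apply/negP => /sub' SS; move: lt'; rewrite ltnNge subset_leq_card.
  + by apply/negP => /sub'' SS; move: lt''; rewrite ltnNge subset_leq_card.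
  apply/hasPn => X X''; apply/negP => X'.
  have := building_neq0 bB (tree_mem t' X').
  by rewrite -(cross X X X' X'') finset.setIid eqxx.
- by move=> X; rewrite memE => /or3P[/eqP -> //|/(tree_mem t')|/(tree_mem t'')].
- move=> X Y; rewrite inE mem_cat memE.
  move=> /or3P[/eqP[-> ->]|/(tree_pair t')[q0 q1]|/(tree_pair t'')[q0 q1]].
  + by rewrite SE eqxx.
  + by rewrite q1 orbT.
  + by rewrite q1 !orbT.
- move=> X Y XN YN; move: (XN) (YN); rewrite !memE.
  move=> /or3P[/eqP ->|X1|X2] /or3P[/eqP ->|Y1|Y2].
  + by constructor 2; exact: fintype.subxx.
  + by constructor 3; exact: subS.
  + by constructor 3; exact: subS.
  + by constructor 2; exact: subS.
  + exact: tree_laminar t' _ _ X1 Y1.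
  + by constructor 1; exact: cross.
  + by constructor 2; exact: subS.
  + by constructor 1; rewrite finset.setIC; exact: cross.
  + exact: tree_laminar t'' _ _ X2 Y2.
- move=> i iS; rewrite memE; move: iS.
  rewrite -{1}SE inE => /orP[/(tree_leaf t') ->|/(tree_leaf t'') ->].
    by rewrite orbT.
  by rewrite !orbT.
- move=> X; rewrite memE => /or3P[/eqP ->|X1|X2] cX.
  + by exists S', S''; rewrite inE eqxx SE.
  + have [Y [Z [q ->]]] := tree_split t' X1 cX.
    by exists Y, Z; rewrite inE mem_cat q orbT.
  + have [Y [Z [q ->]]] := tree_split t'' X2 cX.
    by exists Y, Z; rewrite inE mem_cat q !orbT.
Qed.

End SplittingTree.

Section Cube.
Variables (R : realType) (n : nat) (B : {set {set 'I_n.+1}}).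
Local Notation top := [set: 'I_n.+1]%SET.
Local Notation cover := finset.cover.
Variable s : seq ({set 'I_n.+1} * {set 'I_n.+1}).
Hypotheses (bB : building_set B) (ts : splitting_tree B top s).
Implicit Types (X Y : {set 'I_n.+1}) (N : {set {set 'I_n.+1}}).

Definition tree_set : {set {set 'I_n.+1}} := [set X in nodes top s]%SET.
Local Notation B0 := tree_set.

Let mem_tree X : (X \in B0) = (X \in nodes top s).
Proof. by rewrite inE. Qed.

Let size_s : size s = n.
Proof. by have := tree_size ts; rewrite cardsT card_ord => -[]. Qed.

Let lft (i : 'I_n) := (nth (finset.set0, finset.set0) s i).1.
Let rgt (i : 'I_n) := (nth (finset.set0, finset.set0) s i).2.

Let pair_in (i : 'I_n) : (lft i, rgt i) \in s.
Proof. by rewrite -surjective_pairing mem_nth // size_s. Qed.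

Let lftE (i : 'I_n) : lft i = nth finset.set0 (unzip1 s) i.
Proof. by rewrite (nth_map (finset.set0, finset.set0)) ?size_s. Qed.

Let rgtE (i : 'I_n) : rgt i = nth finset.set0 (unzip2 s) i.
Proof. by rewrite (nth_map (finset.set0, finset.set0)) ?size_s. Qed.

Let in1 (i : 'I_n) : lft i \in unzip1 s.
Proof. by rewrite lftE mem_nth // size_map size_s. Qed.

Let in2 (i : 'I_n) : rgt i \in unzip2 s.
Proof. by rewrite rgtE mem_nth // size_map size_s. Qed.

Let uniq_parts : [/\ forall i, (top == lft i) = false, forall i, (top == rgt i) = false,
  forall i j, (lft i == rgt j) = false, injective lft & injective rgt].
Proof.
have := tree_uniq ts; rewrite cons_uniq mem_cat negb_or cat_uniq.
move=> /andP[/andP[t1 t2] /and3P[u1 /hasPn u12 u2]].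
split=> [i|i|i j|i j|i j].
- by apply: contraNF t1 => /eqP ->; exact: in1.
- by apply: contraNF t2 => /eqP ->; exact: in2.
- by apply: contraTF (in1 i) => /eqP ->; apply: u12; exact: in2.
- by rewrite !lftE => /eqP; rewrite nth_uniq ?size_map ?size_s // => /eqP/val_inj.
- by rewrite !rgtE => /eqP; rewrite nth_uniq ?size_map ?size_s // => /eqP/val_inj.
Qed.

Let nodesP X : X \in B0 -> [\/ X = top, exists i, X = lft i | exists i, X = rgt i].
Proof.
rewrite mem_tree inE mem_cat => /or3P[/eqP ->|X1|X2]; first by constructor 1.
- constructor 2; have lt : (index X (unzip1 s) < n)%N.
    by rewrite -[n in (_ < n)%N]size_s -(size_map fst) index_mem.
  by exists (Ordinal lt); rewrite lftE nth_index.
- constructor 3; have lt : (index X (unzip2 s) < n)%N.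
    by rewrite -[n in (_ < n)%N]size_s -(size_map snd) index_mem.
  by exists (Ordinal lt); rewrite rgtE nth_index.
Qed.

Let lft_in i : lft i \in B0.
Proof. by rewrite mem_tree inE mem_cat in1 orbT. Qed.
Let rgt_in i : rgt i \in B0.
Proof. by rewrite mem_tree inE mem_cat in2 !orbT. Qed.
Let top_in : top \in B0.
Proof. by rewrite mem_tree inE eqxx. Qed.

Lemma tree_set_sub : B0 \subset B.
Proof. by apply/fintype.subsetP => X; rewrite mem_tree; apply: tree_mem. Qed.

Let neq0 X : X \in B0 -> X != finset.set0.
Proof. by move=> /(fintype.subsetP tree_set_sub); apply: building_neq0. Qed.

Lemma tree_set_connected : connected_building_set B0.
Proof.
split; last exact: top_in.
split=> [|i|X Y XB YB XY].
- by apply/negP => /neq0; rewrite eqxx.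
- by rewrite mem_tree (tree_leaf ts) // inE.
rewrite !mem_tree in XB YB.
have [XY0|XsY|YsX] := tree_laminar ts XB YB; first by rewrite XY0 eqxx in XY.
- by have /finset.setUidPr -> := XsY; rewrite mem_tree.
- by have /finset.setUidPl -> := YsX; rewrite mem_tree.
Qed.

(** A node covered by smaller nodes has its two children covered separately, and by
    induction both children then belong to the family. *)
Lemma nested_treeP N : N \subset B0 -> top \in N ->
  nested B0 N <-> forall i, ~ (lft i \in N /\ rgt i \in N).
Proof.
move=> NB tN; split=> [[_ _ cN] i [li ri]|sib].
  have [dis un] := tree_pair ts (pair_in i).
  have := cN [set lft i; rgt i]%SET; rewrite finset.subUset !finset.sub1set li ri.
  have -> : [set lft i; rgt i]%SET != finset.set0.
    by apply/set0Pn; exists (lft i); rewrite !inE eqxx.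
  rewrite cover_set2 mem_tree un => /(_ isT isT isT); rewrite !inE => /orP[]/eqP E.
    have : rgt i \subset lft i by rewrite -E finset.subsetUr.
    by move=> /finset.setIidPr rE; move: (neq0 (rgt_in i)); rewrite -rE dis eqxx.
  have : lft i \subset rgt i by rewrite -E finset.subsetUl.
  by move=> /finset.setIidPl lE; move: (neq0 (lft_in i)); rewrite -lE dis eqxx.
split=> // M; have [k] := ubnP #|cover M|; elim: k M => // k IH M.
rewrite ltnS => Mk MN M0 cM; apply: contraT => cMM.
have proper X : X \in M -> X \proper cover M.
  move=> XM; rewrite finset.properEneq cover_sup // andbT.
  by apply: contraNneq cMM => <-.
have MB X : X \in M -> X \in B0 by move=> /(fintype.subsetP MN)/(fintype.subsetP NB).
have c1 : (1 < #|cover M|)%N.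
  have /set0Pn[X XM] := M0; apply: leq_ltn_trans (proper_card (proper X XM)).
  by rewrite card_gt0 neq0 ?MB.
have cM' := cM; rewrite mem_tree in cM'.
have [Y0 [Z0 [YZs cE]]] := tree_split ts cM' c1.
have [i [YE ZE]] : exists i : 'I_n, Y0 = lft i /\ Z0 = rgt i.
  have lt : (index (Y0, Z0) s < n)%N by rewrite -[n in (_ < n)%N]size_s index_mem.
  by exists (Ordinal lt); rewrite /lft /rgt /= nth_index.
rewrite YE ZE in cE.
have [dis _] := tree_pair ts (pair_in i).
have half X Y : X \in B0 -> Y \in B0 -> X :&: Y = finset.set0 ->
    cover M = X :|: Y -> X \in N.
  move=> XB YB XY cXY; pose M' := [set Z in M | Z \subset X]%SET.
  have cM'X : cover M' = X.
    apply/eqP; rewrite finset.eqEsubset; apply/andP; split.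
      by apply/cover_subP => Z; rewrite inE => /andP[].
    apply/fintype.subsetP => j jX.
    have : j \in cover M by rewrite cXY inE jX.
    move=> /mem_cover[Z ZM jZ]; apply/mem_cover; exists Z => //; rewrite inE ZM /=.
    have ZB := MB Z ZM; rewrite mem_tree in ZB.
    rewrite mem_tree in XB; rewrite mem_tree in YB.
    have [ZX|//|XZ] := tree_laminar ts ZB XB.
      have : j \in Z :&: X by rewrite inE jZ.
      by rewrite ZX inE.
    have ZsXY : Z \subset X :|: Y by rewrite -cXY cover_sup.
    have [ZY|ZsY|YZ] := tree_laminar ts ZB YB.
    - apply/fintype.subsetP => m mZ.
      have := fintype.subsetP ZsXY m mZ; rewrite inE => /orP[//|mY].
      have : m \in Z :&: Y by rewrite inE mZ.
      by rewrite ZY inE.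
    - have : j \in X :&: Y by rewrite inE jX (fintype.subsetP ZsY).
      by rewrite XY inE.
    have := proper Z ZM; rewrite properE => /andP[_ /negP[]].
    by rewrite cXY finset.subUset XZ.
  have M'M : M' \subset M by apply/fintype.subsetP => Z; rewrite inE => /andP[].
  have M'N := fintype.subset_trans M'M MN.
  have ltX : (#|cover M'| < k)%N.
    apply: leq_trans Mk; rewrite cM'X cXY cardsU XY cards0 subn0.
    by rewrite -[X in (X < _)%N]addn0 ltn_add2l card_gt0 neq0.
  have M'0 : M' != finset.set0.
    by apply: contraNneq (neq0 XB) => M'0; rewrite -cM'X M'0 /cover big_set0.
  have := IH M' ltX M'N M'0; rewrite cM'X => /(_ XB).
  exact: (fintype.subsetP M'N).
case: (sib i); split; first by apply: (half _ (rgt i)).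
by apply: (half _ (lft i)); rewrite 1?finset.setIC // finset.setUC.
Qed.

(** The two opposite facets of the cube in direction [i] are labelled by the two
    siblings of the [i]-th pair. *)
Let normal X : 'rV[R]_n := \row_i ((X == lft i)%:R - (X == rgt i)%:R).
Let offset X : R := - \sum_i (X == rgt i)%:R.

Let top_system : (forall y, dot (normal top) y = 0) /\ offset top = 0.
Proof.
have [tl tr _ _ _] := uniq_parts; split=> [y|].
  by rewrite /dot big1 // => i _; rewrite mxE tl tr subrr mul0r.
by rewrite /offset big1 ?oppr0 // => i _; rewrite tr.
Qed.

Let lft_system i : (forall y, dot (normal (lft i)) y = y 0 i) /\ offset (lft i) = 0.
Proof.
have [_ _ lr injl _] := uniq_parts; split=> [y|].
  rewrite /dot (bigD1 i) //= big1 => [|j ji]; rewrite mxE lr.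
    by rewrite eqxx subr0 mul1r addr0.
  by rewrite (inj_eq injl) eq_sym (negPf ji) subrr mul0r.
by rewrite /offset big1 ?oppr0 // => j _; rewrite lr.
Qed.

Let rgt_system i : (forall y, dot (normal (rgt i)) y = - y 0 i) /\ offset (rgt i) = -1.
Proof.
have [_ _ lr _ injr] := uniq_parts; split=> [y|].
  rewrite /dot (bigD1 i) //= big1 => [|j ji]; rewrite mxE [_ == lft _]eq_sym lr.
    by rewrite eqxx sub0r mulN1r addr0.
  by rewrite (inj_eq injr) eq_sym (negPf ji) subrr mul0r.
rewrite /offset (bigD1 i) //= eqxx big1 ?addr0 // => j ji.
by rewrite (inj_eq injr) eq_sym (negPf ji).
Qed.

Let cubeE : cube R n = solutions normal offset B0 finset.set0.
Proof.
apply/seteqP; split=> y /= yc.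
  move=> X XB; rewrite inE; split=> //.
  have [->|[i ->]|[i ->]] := nodesP XB.
  - by have [-> ->] := top_system.
  - by have [-> ->] := lft_system i; have /andP[] := yc i.
  - by have [-> ->] := rgt_system i; rewrite lerN2; have /andP[] := yc i.
move=> i; have [] := yc _ (lft_in i); have [-> ->] := lft_system i => -> _.
by have [] := yc _ (rgt_in i); have [-> ->] := rgt_system i; rewrite lerN2.
Qed.

Lemma cube_complex : has_face_complex (cube R n) (nested B0).
Proof.
rewrite cubeE; apply: system_face_complex => [y yc|N nN].
  have tB X : X \in tight normal offset B0 y -> X \in B0 by case/tightP.
  apply/nested_treeP.
  - by apply/fintype.subsetP.
  - by apply/tightP; have [-> ->] := top_system; split=> //; exact: top_in.
  move=> i [/tightP[_] + /tightP[_]].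
  have [-> ->] := lft_system i; have [-> ->] := rgt_system i => -> /eqP.
  by rewrite eq_sym oppr0 oppr_eq0 oner_eq0.
have [NB tN _] := nN; have /nested_treeP sib := nN.
pose y : 'rV[R]_n := \row_i (if lft i \in N then 0 else
                             if rgt i \in N then 1 else 2^-1).
have h0 : 0 <= 2^-1 :> R by rewrite invr_ge0.
have h1 : 2^-1 <= 1 :> R by rewrite invf_le1 ?ler1n.
have hn0 : (2^-1 == 0 :> R) = false by rewrite invr_eq0 pnatr_eq0.
have hn1 : (2^-1 == 1 :> R) = false by apply/negbTE; rewrite invr_eq1 pnatr_eq1.
exists y.
  rewrite -cubeE => i; rewrite mxE; case: ifP => _; first by rewrite lexx ler01.
  by case: ifP => _; rewrite ?ler01 ?lexx ?h0.
apply/setP => X; have [XB|XB] := boolP (X \in B0); last first.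
  rewrite inE (negPf XB); apply/esym/negbTE.
  by apply: contra XB; apply: (fintype.subsetP NB).
rewrite inE XB /=; have [->|[i ->]|[i ->]] := nodesP XB.
- by have [-> ->] := top_system; rewrite eqxx tN.
- have [-> ->] := lft_system i; rewrite mxE; case: ifP => _; first by rewrite eqxx.
  by case: ifP => _; rewrite ?oner_eq0 ?hn0.
have [-> ->] := rgt_system i; rewrite mxE eqr_opp.
have nsib := sib NB tN i; case: ifP => li.
  by rewrite eq_sym oner_eq0; apply/esym/negP => ri; apply: nsib.
by case: ifP => ri; rewrite ?eqxx ?hn1.
Qed.

End Cube.

(** * From the cube to the permutohedron *)

Lemma full_building_set n :
  connected_building_set [set S : {set 'I_n.+1} | S != finset.set0]%SET.
Proof.
have ne1 (i : 'I_n.+1) (S : {set 'I_n.+1}) : i \in S -> S != finset.set0.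
  by move=> iS; apply/set0Pn; exists i.
split; last by rewrite inE (ne1 ord0) // inE.
split=> [|i|S T]; rewrite !inE ?eqxx //; first by rewrite (ne1 i) // !inE.
by move=> /set0Pn[i iS] _ _; rewrite (ne1 i) // inE iS.
Qed.

Lemma full_splits n (S : {set 'I_n.+1}) : (1 < #|S|)%N ->
  splits [set S : {set 'I_n.+1} | S != finset.set0]%SET S.
Proof.
move=> S1; have /set0Pn[i iS] : S != finset.set0 by rewrite -card_gt0 ltnW.
exists [set i]%SET, (S :\ i); split.
- by rewrite inE; apply/set0Pn; exists i; rewrite !inE.
- by rewrite inE -card_gt0; move: S1; rewrite (cardsD1 i S) iS.
- by apply/setP => j; rewrite !inE; case: eqVneq.
- by rewrite finset.setD1K.
Qed.

Theorem theorem1 (R : realType) (n : nat) (B : {set {set 'I_n.+1}})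
    (hB : connected_building_set B) (hflag : is_flag (nestohedron R B)) :
  obtained_by_codim2_shavings (nestohedron R B) (cube R n) /\
  obtained_by_codim2_shavings (permutohedron R n) (nestohedron R B).
Proof.
have [bB tB] := hB; have Bsplits := flag_splits hB hflag.
have cB := nestohedron_complex R hB; split.
  have [s ts] := exists_splitting_tree bB Bsplits tB.
  apply: (shavings_between (tree_set_connected bB ts)) cB => //.
    exact: tree_set_sub ts.
  exact: cube_complex bB ts.
have hF := full_building_set n.
apply: (shavings_between hB hF.1) cB (nestohedron_complex R hF) => [|S _ S1].
  by apply/fintype.subsetP => S SB; rewrite inE (building_neq0 bB).
exact: full_splits.
Qed.
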